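(* Let $k\ge 2$ be real and let $B=(Q_0,Q_1,Q_2,Q_3)$ be a good block. Then $$\min_{(p_0,\dots,p_3)\in\langle B\rangle}\mathcal{E}_k(p_0,\dots,p_3)\;\ge\;\min_{(p_0,\dots,p_3)\in B}\mathcal{E}_k(p_0,\dots,p_3)-\mathbf{ERR}(B).$$
   Context: Stereographic projection $\Sigma(x,y,z)=(x/(1-z),y/(1-z))$ maps $S^2\setminus\{(0,0,1)\}$ to $\mathbb{R}^2$, with $\Sigma(0,0,1)=\infty$. For $p\in\mathbb{R}^2\cup\{\infty\}$ write $\widehat p=\Sigma^{-1}(p)$, so $\widehat{(x,y)}=\big(\tfrac{2x}{1+x^2+y^2},\tfrac{2y}{1+x^2+y^2},1-\tfrac{2}{1+x^2+y^2}\big)$ and $\widehat\infty=(0,0,1)$. Put $G_k(p,q)=(4-\|\widehat p-\widehat q\|^2)^k=(2+2\,\widehat p\cdot\widehat q)^k$. A dyadic segment is a segment of the $x$-axis of $\mathbb{R}^2$ obtained from $[0,4]\times\{0\}$ by repeated bisection (including $[0,4]\times\{0\}$). A dyadic square is a square obtained from $[-2,2]^2$ by repeatedly cutting into four congruent quarters (including $[-2,2]^2$); it is good if it is contained in $[-3/2,3/2]^2$ and has side length at most $1/2$. For such $Q$ we also write $Q$ for its vertex set (2 endpoints or 4 corners), $\langle Q\rangle$ for its convex hull, $\widehat Q=\Sigma^{-1}(Q)$, $\langle\widehat Q\rangle$ for the convex hull of $\widehat Q$ in $\mathbb{R}^3$, and $\widehat{\langle Q\rangle}=\Sigma^{-1}(\langle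 Q\rangle)$. We also use $Q=\{\infty\}$. For $Q$ a dyadic segment or good dyadic square: $d(Q)$ is the diameter of $\langle\widehat Q\rangle$; $d_1(Q)$ is the length of the longest edge of $\langle\widehat Q\rangle$; $D_Q$ is the smallest closed disk in $\mathbb{R}^2$ whose boundary circle contains $Q$, and $d_2(Q)$ is the Euclidean diameter of $\Sigma^{-1}(D_Q)\subset\mathbb{R}^3$. Let $\chi(D,d)=\frac{d^2}{4D}+\frac{d^4}{2D^3}$. Set $\delta(Q)=\chi(2,d_2(Q))$ if $Q$ is a segment, $\delta(Q)=\max(\chi(1,d_1(Q)),\chi(2,d_2(Q)))$ if $Q$ is a good square, and $d(\{\infty\})=\delta(\{\infty\})=0$. For $Q,Q'$ segments or good squares with vertices $q_i$, $q'_j$: $(Q\cdot Q')_{\max}=\max_{i,j}\widehat q_i\cdot\widehat q'_j+\delta(Q)+\delta(Q')+\delta(Q)\delta(Q')$ and $(Q\cdot\{\infty\})_{\max}=\max_i\widehat q_i\cdot(0,0,1)$. Let $T(Q,Q')=2+2(Q\cdot Q')_{\max}$ and $\epsilon(Q,Q')=\frac12k(k-1)T(Q,Q')^{k-2}d(Q)^2+2kT(Q,Q')^{k-1}\delta(Q)$, with $\epsilon(\{\infty\},Q')=0$. A good block is $B=(Q_0,Q_1,Q_2,Q_3)$ with $Q_0$ a dyadic segment and $Q_1,Q_2,Q_3$ good dyadic squares; set $Q_4=\{\infty\}$. $\langle B\rangle$ is the set of $(p_0,\dots,p_3)$ with $p_i\in\langle Q_i\rangle$, and $B$ also denotes the finite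 set of vertex configurations $(p_0,\dots,p_3)$ with $p_i\in Q_i$. The energy is $\mathcal{E}_k(p_0,\dots,p_3)=\sum_{0\le i<j\le4}G_k(p_i,p_j)$ with $p_4=\infty$. Finally $\mathbf{ERR}(B)=\sum_{i=0}^3\sum_{j\in\{0,\dots,4\},\,j\ne i}\epsilon(Q_i,Q_j)$. *)

(* Defs.v *)
From HB Require Import structures.
From mathcomp Require Import all_boot all_order all_algebra.
From mathcomp Require Import all_classical all_reals all_analysis.
Set Implicit Arguments. Unset Strict Implicit. Unset Printing Implicit Defensive.
Import Order.TTheory GRing.Theory Num.Theory.
Local Open Scope classical_set_scope.
Local Open Scope ring_scope.

Section Defs.
Variable R : realType.

Definition pt2 := (R * R)%type.
Definition pt3 := (R * R * R)%type.

Definition dot3 (u v : pt3) : R := u.1.1 * v.1.1 + u.1.2 * v.1.2 + u.2 * v.2.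
Definition dist3 (u v : pt3) : R :=
  Num.sqrt ((u.1.1 - v.1.1) ^+ 2 + (u.1.2 - v.1.2) ^+ 2 + (u.2 - v.2) ^+ 2).

(* inverse stereographic projection  \hat p  *)
Definition hat (p : pt2) : pt3 :=
  let r := 1 + p.1 ^+ 2 + p.2 ^+ 2 in (2 * p.1 / r, 2 * p.2 / r, 1 - 2 / r).
Definition north : pt3 := (0, 0, 1).

Definition Gs (k : R) (u v : pt3) : R := powR (2 + 2 * dot3 u v) k.

Definition diam3 (S : set pt3) : R := sup [set dist3 x y | x in S & y in S].

Definition hull3 (ps : seq pt3) : set pt3 :=
  [set x | exists w : nat -> R, (forall i, 0 <= w i) /\
     \sum_(i < size ps) w i = 1 /\
     x = (\sum_(i < size ps) w i * (nth north ps i).1.1,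
          \sum_(i < size ps) w i * (nth north ps i).1.2,
          \sum_(i < size ps) w i * (nth north ps i).2)].

Definition maxlist (s : seq R) : R := foldr Num.max (head 0 s) s.
Definition minlist (s : seq R) : R := foldr Num.min (head 0 s) s.

(* Cells: dyadic segments Seg n j = [4j/2^n, 4(j+1)/2^n] x {0} (j < 2^n),
   dyadic squares Sq n i j = [-2+i s, -2+(i+1)s] x [-2+j s, -2+(j+1)s]
   with s = 4/2^n (i,j < 2^n), and the cell {oo}. *)
Inductive cell := Seg of nat & nat | Sq of nat & nat & nat | Inf.

Definition side (n : nat) : R := 4 / (2 ^+ n).

Definition dyadic_segment (Q : cell) : Prop :=
  match Q with Seg n j => (j < 2 ^ n)%N | _ => False end.

Definition sq_x0 (n i : nat) : R := -2 + i%:R * side n.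

Definition dyadic_square (Q : cell) : Prop :=
  match Q with Sq n i j => (i < 2 ^ n)%N /\ (j < 2 ^ n)%N | _ => False end.

Definition good_square (Q : cell) : Prop :=
  match Q with
  | Sq n i j => dyadic_square Q /\
      -(3/2) <= sq_x0 n i /\ sq_x0 n i + side n <= 3/2 /\
      -(3/2) <= sq_x0 n j /\ sq_x0 n j + side n <= 3/2 /\
      side n <= 1/2
  | _ => False
  end.

Definition verts (Q : cell) : seq pt2 :=
  match Q with
  | Seg n j => [:: (j%:R * side n, 0); (j.+1%:R * side n, 0)]
  | Sq n i j => let x := sq_x0 n i in let y := sq_x0 n j in let s := side n in
      [:: (x, y); (x + s, y); (x + s, y + s); (x, y + s)]
  | Inf => [::]
  end.

Definition hverts (Q : cell) : seq pt3 :=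
  match Q with Inf => [:: north] | _ => map hat (verts Q) end.

Definition chull (Q : cell) : set pt2 :=
  match Q with
  | Seg n j => [set p | p.2 = 0 /\ j%:R * side n <= p.1 <= j.+1%:R * side n]
  | Sq n i j => [set p | sq_x0 n i <= p.1 <= sq_x0 n i + side n /\
                          sq_x0 n j <= p.2 <= sq_x0 n j + side n]
  | Inf => set0
  end.

(* D_Q : smallest closed disk whose boundary circle contains Q
   (disk on the diameter for a segment, circumscribed disk for a square) *)
Definition DQ (Q : cell) : set pt2 :=
  match Q with
  | Seg n j => let c := ((j%:R + 1/2) * side n, 0) in let r := side n / 2 in
      [set p | (p.1 - c.1) ^+ 2 + (p.2 - c.2) ^+ 2 <= r ^+ 2]
  | Sq n i j => let c := (sq_x0 n i + side n / 2, sq_x0 n j + side n / 2) in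
      let r2 := side n ^+ 2 / 2 in
      [set p | (p.1 - c.1) ^+ 2 + (p.2 - c.2) ^+ 2 <= r2]
  | Inf => set0
  end.

Definition dQ (Q : cell) : R :=
  match Q with Inf => 0 | _ => diam3 (hull3 (hverts Q)) end.

(* d_1(Q): longest edge of <\hat Q>; for a square the edges of the planar
   quadrilateral <\hat Q> join images of adjacent corners *)
Definition d1Q (Q : cell) : R :=
  let h := hverts Q in
  maxlist [seq dist3 (nth north h i) (nth north h ((i.+1) %% size h)) |
           i <- iota 0 (size h)].

Definition d2Q (Q : cell) : R := diam3 (hat @` DQ Q).

Definition chi (D d : R) : R := d ^+ 2 / (4 * D) + d ^+ 4 / (2 * D ^+ 3).

Definition deltaQ (Q : cell) : R :=
  match Q with
  | Seg _ _ => chi 2 (d2Q Q)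
  | Sq _ _ _ => Num.max (chi 1 (d1Q Q)) (chi 2 (d2Q Q))
  | Inf => 0
  end.

Definition dotmax (Q Q' : cell) : R :=
  match Q' with
  | Inf => maxlist [seq dot3 q north | q <- hverts Q]
  | _ => maxlist [seq dot3 q q' | q <- hverts Q, q' <- hverts Q']
         + deltaQ Q + deltaQ Q' + deltaQ Q * deltaQ Q'
  end.

Definition TQ (Q Q' : cell) : R := 2 + 2 * dotmax Q Q'.

Definition epsQ (k : R) (Q Q' : cell) : R :=
  match Q with
  | Inf => 0
  | _ => 2^-1 * k * (k - 1) * powR (TQ Q Q') (k - 2) * dQ Q ^+ 2
         + 2 * k * powR (TQ Q Q') (k - 1) * deltaQ Q
  end.

Definition energy_hat (k : R) (P : 'I_5 -> pt3) : R :=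
  \sum_(i < 5) \sum_(j < 5 | (i < j)%N) Gs k (P i) (P j).

Definition energy (k : R) (p0 p1 p2 p3 : pt2) : R :=
  energy_hat k (fun i : 'I_5 =>
    nth north [:: hat p0; hat p1; hat p2; hat p3; north] i).

Definition min_vertex_energy (k : R) (Q0 Q1 Q2 Q3 : cell) : R :=
  minlist [seq energy k c.1.1 c.1.2 c.2.1 c.2.2 |
           c <- [seq (a, b) | a <- [seq (x, y) | x <- verts Q0, y <- verts Q1],
                              b <- [seq (x, y) | x <- verts Q2, y <- verts Q3]]].

Definition ERR (k : R) (Q0 Q1 Q2 Q3 : cell) : R :=
  let Qs := [:: Q0; Q1; Q2; Q3; Inf] in
  \sum_(i < 4) \sum_(j < 5 | j != i :> nat) epsQ k (nth Inf Qs i) (nth Inf Qs j).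

End Defs.

(* Main.v *)
Require Import Defs.
From HB Require Import structures.
From mathcomp Require Import all_boot all_order all_algebra.
From mathcomp Require Import all_classical all_reals all_analysis.
From mathcomp Require Import ring lra.

(** Each $\hat p$ with $p\in\langle Q\rangle$ lies within $\delta(Q)$ of a
convex combination $z=\sum_i w_i\hat q_i$ of the images of the vertices of $Q$.
Write $G_k(\hat p,v)=f(2+2\,\hat p\cdot v)$ with $f(t)=t^k$.  For every unit
vector $v$, the numbers $2+2\,\hat q_i\cdot v$ lie in an interval of length
$2d(Q)$, so their variance is at most $d(Q)^2$ and the Jensen gap
$\sum_i w_if(2+2\,\hat q_i\cdot v)-f(2+2z\cdot v)$ is at most
$\frac12k(k-1)T^{k-2}d(Q)^2$; the tangent of the convex $f$ at $2+2z\cdot v$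
gives $f(2+2z\cdot v)-f(2+2\,\hat p\cdot v)\le2kT^{k-1}\delta(Q)$.  As the
weights do not depend on $v$, some vertex $q_i$ can replace $p$ in the energy
at the cost of $\sum_j\epsilon(Q,Q_j)$; this is done for one point after the
other.

For a rectangle in the first quadrant, a segment being a flat one, $z$ is the
point where the radius to $\hat p$ meets the plane of the four $\hat q_i$, if
that point is in $\langle\widehat Q\rangle$: its distance to $\hat p$ is at most
the height of the spherical cap, hence at most $\chi(2,d_2)$.  Otherwise the
radius passes beyond an edge $[a,b]$ facing the origin, and $z$ is the foot of
the perpendicular from $\hat p$ to that edge.  Then $\hat p-z$ is a nonnegative
combination of two vectors at an angle of at most 60 degrees with $z$, so that
$|\hat p-z|\le2z\cdot(\hat p-z)$.  Since
$|\hat p-z|^2+2z\cdot(\hat p-z)=1-|z|^2\le|a-b|^2/4$, this gives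
$|\hat p-z|\le|a-b|^2/4\le\chi(1,d_1)$. *)

Set Implicit Arguments.
Unset Strict Implicit.
Unset Printing Implicit Defensive.
Import Order.TTheory GRing.Theory Num.Theory.
Import numFieldNormedType.Exports.
Local Open Scope classical_set_scope.
Local Open Scope ring_scope.

(** * Power functions and weighted means *)

Section PowerFunction.
Variable R : realType.
Implicit Types a b k s t x T : R.

Lemma continuous_within_powR k a b : 0 < k -> 0 <= a ->
  {within `[a, b], continuous (fun x => powR x k)}.
Proof.
move=> k0 a0; have [ba|ab] := leP b a.
  have [<-|ne] := eqVneq a b.
    by rewrite set_itv1; exact: continuous_subspace1.
  rewrite set_itv_ge ?bnd_simp -?ltNge ?lt_neqAle 1?eq_sym ?ne//.
  exact: continuous_subspace0.
have cont x : 0 < x -> {for x, continuous (fun x => powR x k)}.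
  move=> x0; apply/differentiable_continuous/derivable1_diffP.
  by have [] := is_derive1_powR k x0.
apply/continuous_within_itvP => //; split.
- by move=> x; rewrite in_itv /= => /andP[ax _]; apply/cont/(le_lt_trans a0).
- move: a0; rewrite le_eqVlt => /predU1P[<-|a0].
    by rewrite powR0 ?gt_eqF//; exact: powR_cvg0.
  exact/cvg_at_right_filter/cont.
- exact/cvg_at_left_filter/cont/(le_lt_trans a0).
Qed.

Lemma powR_tangent_le k a b : 1 <= k -> 0 <= a -> 0 <= b ->
  powR a k + k * powR a (k - 1) * (b - a) <= powR b k.
Proof.
rewrite le_eqVlt => /predU1P[<-|k1] a0 b0.
  by rewrite !powRr1// subrr powRr0; lra.
have [k0 k10] : 0 < k /\ 0 < k - 1 by split; lra.
(* Young's inequality for the exponents k / (k - 1) and k *)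
have /(ler_wpM2l (ltW k0)) :
    powR a (k - 1) * b <= powR a k / (k / (k - 1)) + powR b k / k.
  have := @conjugate_powR R (powR a (k - 1)) b (k / (k - 1)) k.
  rewrite -powRrM [(k - 1) * _]mulrC divfK ?gt_eqF//; apply=> //.
  - exact: powR_ge0.
  - exact: divr_gt0.
  - by field; rewrite !gt_eqF.
have -> : k * (powR a k / (k / (k - 1)) + powR b k / k)
    = (k - 1) * powR a k + powR b k by field; rewrite !gt_eqF.
have := congr1 ( *%R k) (mulr_powRB1 a0 k0); lra.
Qed.

Lemma quadratic_upper_bound (f df : R -> R) (a b M : R) :
  {within `[a, b], continuous f} ->
  {in `]a, b[, forall x, is_derive x 1 f (df x)} ->
  {in `[a, b] &, forall x y, x <= y -> df y - df x <= M * (y - x)} ->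
  {in `[a, b] &, forall s t,
    f t <= f s + df s * (t - s) + M / 2 * (t - s) ^+ 2}.
Proof.
move=> cf f_df df_lip s t; rewrite !in_itv /= => /andP[a_s sb] /andP[a_t tb].
pose q x := df s * (x - s) + M / 2 * (x - s) ^+ 2.
pose g := f - q; pose dg x := df x - (df s + M * (x - s)).
have g_dg c d : a <= c -> d <= b ->
    {in `]c, d[, forall x, is_derive x 1 g (dg x)}.
  move=> ac db x; rewrite in_itv /= => /andP[cx xd].
  have f_dfx : is_derive x 1 f (df x).
    by apply: f_df; rewrite in_itv /= (le_lt_trans ac) ?(lt_le_trans xd).
  have sub_s : is_derive x 1 (fun x : R => x - s) 1.
    by apply: is_derive_eq; rewrite subr0.
  by apply: is_derive_eq; rewrite /dg /= /GRing.scale /=; lra.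
have cg c d : a <= c -> d <= b -> {within `[c, d], continuous g}.
  move=> ac db x; apply: (@continuousB _ _ (subspace `[c, d])).
    apply: (continuous_subspaceW _ cf) => y /=.
    by rewrite !in_itv /= => /andP[/(le_trans ac)-> /le_trans->].
  apply: continuous_subspaceT => y.
  exact/differentiable_continuous/derivable1_diffP.
suff : f t - q t <= f s - q s by rewrite /q subrr; lra.
have [st|/ltW ts] := leP s t.
  have [c] := MVT_segment st (g_dg _ _ a_s tb) (cg _ _ a_s tb).
  rewrite in_itv /= => /andP[sc ct] gE.
  rewrite -subr_le0 [leLHS]gE mulr_le0_ge0 ?subr_ge0// /dg.
  have := df_lip s c; rewrite !in_itv /= a_s sb (le_trans a_s sc).
  by rewrite (le_trans ct tb) => /(_ isT isT sc); lra.
have [c] := MVT_segment ts (g_dg _ _ a_t sb) (cg _ _ a_t sb).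
rewrite in_itv /= => /andP[tc cs] gE.
rewrite -subr_ge0 [leRHS]gE mulr_ge0 ?subr_ge0// /dg.
have := df_lip c s; rewrite !in_itv /= a_s sb (le_trans a_t tc).
by rewrite (le_trans cs sb) => /(_ isT isT cs); lra.
Qed.

Lemma powR_taylor_le k T : 2 <= k -> {in `[0, T] &, forall s t,
  powR t k <= powR s k + k * powR s (k - 1) * (t - s)
              + k * (k - 1) * powR T (k - 2) / 2 * (t - s) ^+ 2}.
Proof.
move=> k2.
apply: quadratic_upper_bound (fun x => k * powR x (k - 1)) _ _ _ _ _ _.
- by apply: continuous_within_powR; lra.
- by move=> x; rewrite in_itv /= => /andP[x0 _]; exact: is_derive1_powR.
move=> x y; rewrite !in_itv /= => /andP[x0 xT] /andP[y0 yT] xy.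
have k0 : 0 < k by lra.
have tangent :
    powR y (k - 1) + (k - 1) * powR y (k - 2) * (x - y) <= powR x (k - 1).
  have -> : k - 2 = k - 1 - 1 by lra.
  by apply: powR_tangent_le => //; lra.
have : powR y (k - 2) * (y - x) <= powR T (k - 2) * (y - x).
  rewrite ler_wpM2r ?subr_ge0//.
  by apply: ge0_ler_powR; rewrite ?nnegrE//; lra.
rewrite -(@ler_pM2l _ (k - 1)); last lra.
rewrite -mulrBr -2!(mulrA k) (ler_pM2l k0); lra.
Qed.

End PowerFunction.

Section WeightedMeans.
Variables (R : realFieldType) (n : nat).
Implicit Types (w f t : nat -> R) (D M : R).

Definition weights w := (forall i, 0 <= w i) /\ \sum_(i < n) w i = 1.

Lemma weighted_mean_le w f M : weights w ->
  (forall i, (i < n)%N -> f i <= M) -> \sum_(i < n) w i * f i <= M.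
Proof.
move=> [w0 w1] fM; rewrite -[leRHS]mul1r -w1 mulr_suml.
by apply: ler_sum => i _; rewrite ler_wpM2l// fM.
Qed.

Lemma weighted_mean_ge w f M : weights w ->
  (forall i, (i < n)%N -> M <= f i) -> M <= \sum_(i < n) w i * f i.
Proof.
move=> [w0 w1] fM; rewrite -[leLHS]mul1r -w1 mulr_suml.
by apply: ler_sum => i _; rewrite ler_wpM2l// fM.
Qed.

Lemma weights_arg_min w f : weights w ->
  exists2 i, (i < n)%N & forall j, (j < n)%N -> f i <= f j.
Proof.
move=> [_ w1]; case: n w1 => [|m] w1.
  by move: w1; rewrite big_ord0 => /esym/eqP; rewrite oner_eq0.
have [i _ i_min] :=
  @arg_minP _ _ _ (@ord0 m) predT (fun i : 'I_m.+1 => f i) isT.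
by exists i => // j jm; exact: (i_min (Ordinal jm)).
Qed.

Lemma weighted_mean_ex_le w f M : weights w -> \sum_(i < n) w i * f i <= M ->
  exists2 i, (i < n)%N & f i <= M.
Proof.
move=> ww fM; have [i i_n i_min] := weights_arg_min f ww.
by exists i => //; apply: le_trans fM; exact: weighted_mean_ge.
Qed.

Lemma weighted_mean_affine w t a b : weights w ->
  \sum_(i < n) w i * (a + b * t i) = a + b * \sum_(i < n) w i * t i.
Proof.
move=> [_ w1]; rewrite mulr_sumr -[in RHS](mulr1 a) -w1 mulr_sumr -big_split /=.
by apply: eq_bigr => i _; ring.
Qed.

(* The variance is at most the mean of the squared distance to the midpoint of
   an interval of length [D] containing all values. *)
Lemma weighted_variance_le w t D (m := \sum_(i < n) w i * t i) : weights w ->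
  (forall i j, (i < n)%N -> (j < n)%N -> t i - t j <= D) ->
  \sum_(i < n) w i * (t i - m) ^+ 2 <= (D / 2) ^+ 2.
Proof.
move=> ww tD; have [a a_n a_min] := weights_arg_min t ww.
pose c := t a + D / 2; pose b := - 2 * (m - c).
apply: (@le_trans _ _ (\sum_(i < n)
    w i * ((D / 2) ^+ 2 - (m - c) ^+ 2 - b * m + b * t i))).
  apply: ler_sum => i _; rewrite ler_wpM2l//; first by case: ww.
  have : 0 <= (t i - t a) * (t a + D - t i).
    by rewrite mulr_ge0// ?subr_ge0 ?a_min// -lerBlDl tD.
  by rewrite /b /c; lra.
by rewrite weighted_mean_affine// -/m; have := sqr_ge0 (m - c); lra.
Qed.

End WeightedMeans.

Lemma powR_jensen_gap (R : realType) n (w t : nat -> R) k D T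
    (m := \sum_(i < n) w i * t i) : 2 <= k -> weights n w ->
  (forall i, (i < n)%N -> 0 <= t i <= T) ->
  (forall i j, (i < n)%N -> (j < n)%N -> t i - t j <= D) ->
  \sum_(i < n) w i * powR (t i) k <=
    powR m k + k * (k - 1) * powR T (k - 2) / 2 * (D / 2) ^+ 2.
Proof.
move=> k2 ww tT tD; set C := _ / 2.
have C0 : 0 <= C.
  by rewrite divr_ge0// mulr_ge0 ?powR_ge0// mulr_ge0//; lra.
have m_itv : m \in `[0, T].
  rewrite in_itv /= weighted_mean_ge ?weighted_mean_le// => i /tT/andP[]//.
have taylor : \sum_(i < n) w i * powR (t i) k <=
    \sum_(i < n) w i * (powR m k - k * powR m (k - 1) * m
      + k * powR m (k - 1) * t i) + C * \sum_(i < n) w i * (t i - m) ^+ 2.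
  rewrite [C * _]mulr_sumr -big_split; apply: ler_sum => i _ /=.
  rewrite mulrCA -mulrDr ler_wpM2l//; first by case: ww.
  by have := powR_taylor_le k2 m_itv (tT i (ltn_ord i)); rewrite /C; lra.
apply: (le_trans taylor); rewrite weighted_mean_affine// -/m subrK lerD2l.
by rewrite ler_wpM2l// weighted_variance_le.
Qed.

(** * Euclidean space *)

Section EuclideanSpace.
Variable R : realType.
Implicit Types (a b e n u v w : pt3 R) (c s t x y : R).

Lemma scale3E c v : c *: v = (c * v.1.1, c * v.1.2, c * v.2).
Proof. by []. Qed.

Lemma dot3C u v : dot3 u v = dot3 v u.
Proof. by rewrite /dot3; ring. Qed.

Lemma dot3_is_linear v : scalar (dot3 v).
Proof. by move=> c u w; rewrite scale3E /dot3 /=; ring. Qed.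

HB.instance Definition _ v :=
  GRing.isLinear.Build R (pt3 R) R _ (dot3 v) (dot3_is_linear v).

Lemma dot3Dr u v w : dot3 u (v + w) = dot3 u v + dot3 u w.
Proof. exact: linearD. Qed.

Lemma dot3Br u v w : dot3 u (v - w) = dot3 u v - dot3 u w.
Proof. exact: linearB. Qed.

Lemma dot3Zr c u v : dot3 u (c *: v) = c * dot3 u v.
Proof. exact: linearZ. Qed.

Lemma dot3Dl u v w : dot3 (u + v) w = dot3 u w + dot3 v w.
Proof. by rewrite !(dot3C _ w) dot3Dr. Qed.

Lemma dot3Bl u v w : dot3 (u - v) w = dot3 u w - dot3 v w.
Proof. by rewrite !(dot3C _ w) dot3Br. Qed.

Lemma dot3Zl c u v : dot3 (c *: u) v = c * dot3 u v.
Proof. by rewrite !(dot3C _ v) dot3Zr. Qed.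

Lemma dot3_sumr (m : nat) (c : nat -> R) (q : nat -> pt3 R) u :
  dot3 u (\sum_(i < m) c i *: q i) = \sum_(i < m) c i * dot3 u (q i).
Proof. by rewrite linear_sum; apply: eq_bigr => i _; rewrite linearZ. Qed.

Lemma dot3_ge0 u : 0 <= dot3 u u.
Proof. by rewrite /dot3 -!expr2 !addr_ge0// sqr_ge0. Qed.

Lemma sqr_dot3_le u v : dot3 u v ^+ 2 <= dot3 u u * dot3 v v.
Proof.
rewrite -subr_ge0; set D := _ - _.
have -> : D = (u.1.1 * v.1.2 - u.1.2 * v.1.1) ^+ 2
  + (u.1.2 * v.2 - u.2 * v.1.2) ^+ 2 + (u.2 * v.1.1 - u.1.1 * v.2) ^+ 2.
  by rewrite /D /dot3; ring.
by rewrite !addr_ge0// sqr_ge0.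
Qed.

Lemma dot3_geN1 u v : dot3 u u <= 1 -> dot3 v v <= 1 -> -1 <= dot3 u v.
Proof.
move=> u1 v1; have := dot3_ge0 (u + v).
rewrite dot3Dl !dot3Dr (dot3C v u); lra.
Qed.

Definition norm3 u : R := Num.sqrt (dot3 u u).

Lemma norm3_ge0 u : 0 <= norm3 u.
Proof. exact: sqrtr_ge0. Qed.

Lemma sqr_norm3 u : norm3 u ^+ 2 = dot3 u u.
Proof. by rewrite sqr_sqrtr ?dot3_ge0. Qed.

Lemma dot3_le_norm u v : dot3 u v <= norm3 u * norm3 v.
Proof.
apply: le_trans (ler_norm _) _.
by rewrite -sqrtr_sqr -sqrtrM ?dot3_ge0// ler_wsqrtr// sqr_dot3_le.
Qed.

Lemma ler_norm3D u v : norm3 (u + v) <= norm3 u + norm3 v.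
Proof.
rewrite -(@ler_pXn2r _ 2)// ?nnegrE ?addr_ge0 ?norm3_ge0//.
rewrite sqrrD !sqr_norm3 dot3Dl !dot3Dr (dot3C v u).
by have := dot3_le_norm u v; lra.
Qed.

Lemma norm3Z c u : 0 <= c -> norm3 (c *: u) = c * norm3 u.
Proof.
move=> c0; rewrite /norm3 dot3Zl dot3Zr mulrA -expr2.
by rewrite sqrtrM ?sqr_ge0// sqrtr_sqr ger0_norm.
Qed.

Lemma dist3E u v : dist3 u v = norm3 (u - v).
Proof. by rewrite /dist3 /norm3 /dot3 !expr2. Qed.

Lemma dist3_ge0 u v : 0 <= dist3 u v.
Proof. by rewrite dist3E norm3_ge0. Qed.

Lemma dist3xx u : dist3 u u = 0.
Proof. by rewrite dist3E subrr /norm3 linear0 sqrtr0. Qed.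

Lemma dist3C u v : dist3 u v = dist3 v u.
Proof. by rewrite /dist3; congr Num.sqrt; ring. Qed.

Lemma sqr_dist3 u v : dist3 u v ^+ 2 = dot3 u u + dot3 v v - 2 * dot3 u v.
Proof. by rewrite dist3E sqr_norm3 dot3Bl !dot3Br (dot3C v u); ring. Qed.

Lemma dist3_isometry (f : {linear pt3 R -> pt3 R}) u v :
  (forall w, dot3 (f w) (f w) = dot3 w w) -> dist3 (f u) (f v) = dist3 u v.
Proof. by move=> f_isom; rewrite !dist3E -linearB /norm3 f_isom. Qed.

Lemma dot3_sub_le_dist u v w :
  dot3 w w <= 1 -> dot3 u w - dot3 v w <= dist3 u v.
Proof.
move=> w1; rewrite -dot3Bl dist3E; apply: (le_trans (dot3_le_norm _ _)).
by rewrite ler_piMr ?norm3_ge0// -[leRHS]sqrtr1 ler_wsqrtr.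
Qed.

Lemma dist3_le_diam3 (A : set (pt3 R)) u v : {in A, forall w, dot3 w w <= 1} ->
  A u -> A v -> dist3 u v <= diam3 A.
Proof.
move=> A1 Au Av; apply: ub_le_sup; last by exists u => //; exists v.
exists 2 => _ [a Aa [b Ab <-]].
have [a1 b1] := (A1 _ (mem_set Aa), A1 _ (mem_set Ab)).
rewrite -(@ler_pXn2r _ 2)// ?nnegrE ?dist3_ge0// sqr_dist3.
by have := dot3_geN1 a1 b1; lra.
Qed.

Definition reject e u : pt3 R := u - (dot3 e u / dot3 e e) *: e.

Lemma reject_is_linear e : linear (reject e).
Proof.
move=> c u v; rewrite /reject dot3Dr dot3Zr mulrDl scalerDl -mulrA -scalerA.
by rewrite scalerBr opprD addrACA.
Qed.

HB.instance Definition _ e :=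
  GRing.isLinear.Build R (pt3 R) (pt3 R) _ (reject e) (reject_is_linear e).

Lemma reject_self e : dot3 e e != 0 -> reject e e = 0.
Proof. by move=> e0; rewrite /reject divff// scale1r subrr. Qed.

Lemma dot3_rejectr e u v :
  dot3 u (reject e v) = dot3 u v - dot3 e u * dot3 e v / dot3 e e.
Proof. by rewrite dot3Br dot3Zr (dot3C u e); ring. Qed.

Lemma dot3_reject_self e u : dot3 e e != 0 -> dot3 e (reject e u) = 0.
Proof.
by move=> e0; rewrite dot3_rejectr mulrAC divff// mul1r subrr.
Qed.

Lemma dot3_reject e u v : dot3 e e != 0 ->
  dot3 (reject e u) (reject e v) = dot3 u (reject e v).
Proof.
by move=> e0; rewrite {1}/reject dot3Bl dot3Zl dot3_reject_self// mulr0 subr0.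
Qed.

Lemma dist3_chord_le a b u t (w := (1 - t) *: a + t *: b) :
  dot3 a a = 1 -> dot3 b b = 1 -> dot3 u u = 1 ->
  norm3 (u - w) <= 2 * dot3 w (u - w) -> dist3 u w <= dist3 a b ^+ 2 / 4.
Proof.
move=> a1 b1 u1 angle.
have ww : dot3 w w = 1 - t * (1 - t) * dist3 a b ^+ 2.
  rewrite /w sqr_dist3 dot3Dl !dot3Dr !dot3Zl !dot3Zr (dot3C b a) a1 b1.
  by ring.
have : norm3 (u - w) ^+ 2 + 2 * dot3 w (u - w) + dot3 w w = 1.
  rewrite sqr_norm3 -[RHS]u1 dot3Bl !dot3Br (dot3C w u); ring.
have : t * (1 - t) * dist3 a b ^+ 2 <= 1 / 4 * dist3 a b ^+ 2.
  by rewrite ler_wpM2r ?sqr_ge0//; have := sqr_ge0 (t - 1 / 2); lra.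
by have := sqr_ge0 (norm3 (u - w)); rewrite (dist3E u); lra.
Qed.

Lemma norm3_reject_edge_le a b : dot3 a a = 1 -> dot3 b b = 1 ->
  0 < dist3 a b ^+ 2 <= 3 ->
  norm3 (reject (b - a) a) <= 2 * dot3 a (reject (b - a) a).
Proof.
move=> a1 b1 /andP[ab0 ab3]; set e := b - a.
have ee : dot3 e e = dist3 a b ^+ 2 by rewrite dist3C dist3E sqr_norm3.
have ee0 : dot3 e e != 0 by rewrite ee gt_eqF.
have ea : dot3 e a = - (dist3 a b ^+ 2 / 2).
  by rewrite sqr_dist3 dot3Bl (dot3C b a) a1 b1; field.
rewrite -dot3_reject// -sqr_norm3.
suff : 1 / 4 <= norm3 (reject e a) ^+ 2.
  by have := norm3_ge0 (reject e a); nra.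
rewrite sqr_norm3 dot3_reject// dot3_rejectr a1 ea ee.
set l := dist3 a b; have -> : 1 - - (l ^+ 2 / 2) * - (l ^+ 2 / 2) / l ^+ 2
    = 1 - l ^+ 2 / 4 by field; rewrite -sqrf_eq0 gt_eqF.
by rewrite /l; lra.
Qed.

(* The rejection of [u - a] along the edge is a nonnegative combination of
   those of [a] and [a - n], each at an angle of at most 60 degrees with the
   foot of the perpendicular from [u]. *)
Lemma dist3_edge_le a b n u x y t :
  dot3 a a = 1 -> dot3 b b = 1 -> dot3 u u = 1 ->
  0 < dist3 a b ^+ 2 <= 3 ->
  u = x *: a + y *: b - t *: n -> 0 <= t -> 1 + t <= x + y ->
  dist3 u b ^+ 2 <= dist3 u a ^+ 2 + dist3 a b ^+ 2 ->
  dist3 u a ^+ 2 <= dist3 u b ^+ 2 + dist3 a b ^+ 2 ->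
  norm3 (reject (b - a) (a - n)) <= 2 * dot3 a (reject (b - a) (a - n)) ->
  exists2 s, 0 <= s <= 1 &
    dist3 u ((1 - s) *: a + s *: b) <= dist3 a b ^+ 2 / 4.
Proof.
move=> a1 b1 u1 ab_itv uE t0 xyt acute_a acute_b angle_n.
have /andP[ab0 _] := ab_itv.
set e := b - a in angle_n *; pose s := dot3 e (u - a) / dot3 e e.
have ee : dot3 e e = dist3 a b ^+ 2 by rewrite dist3C dist3E sqr_norm3.
have ee0 : dot3 e e != 0 by rewrite ee gt_eqF.
have eu : dot3 e (u - a) =
    (dist3 u a ^+ 2 + dist3 a b ^+ 2 - dist3 u b ^+ 2) / 2.
  rewrite !sqr_dist3 dot3Bl !dot3Br (dot3C b u) (dot3C a u) (dot3C b a) a1 b1.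
  by field.
exists s; first by rewrite /s ee eu divr_ge0 ?ler_pdivrMr//= ?(ltW ab0); lra.
apply: dist3_chord_le => //.
have -> : (1 - s) *: a + s *: b = a + s *: e.
  by rewrite scalerBl scalerBr scale1r addrAC addrA.
rewrite opprD addrA -/(reject e (u - a)).
rewrite dot3Dl dot3Zl dot3_reject_self// mulr0 addr0.
have reject_b : reject e b = reject e a.
  by apply: subr0_eq; rewrite -(linearB (reject e)); exact: reject_self.
have -> : reject e (u - a) =
    (x + y - 1 - t) *: reject e a + t *: reject e (a - n).
  rewrite uE 3!(linearB (reject e)) (linearD (reject e)).
  rewrite !(linearZZ (reject e)) /= reject_b.
  move: (reject e a) (reject e n) => v w.
  by rewrite scalerBr !scalerBl scalerDl scale1r addrA subrK addrAC.
have angle_a := norm3_reject_edge_le a1 b1 ab_itv.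
rewrite dot3Dr !dot3Zr; apply: (le_trans (ler_norm3D _ _)).
rewrite !norm3Z//; last lra.
have : (x + y - 1 - t) * norm3 (reject e a) <=
    (x + y - 1 - t) * (2 * dot3 a (reject e a)).
  by apply: ler_wpM2l => //; lra.
by have := ler_wpM2l t0 angle_n; lra.
Qed.

End EuclideanSpace.

(** * Convex hulls *)

Lemma convex_setP (R : numDomainType) (M : lmodType R) (A : set M) :
  convex_set A <->
  (forall u v (c : R), 0 <= c <= 1 -> A u -> A v -> A ((1 - c) *: u + c *: v)).
Proof.
split=> [cA u v c /andP[c0 c1] Au Av|cA u v c /set_mem Au /set_mem Av].
  rewrite addrC; apply/set_mem; apply: (cA v u (Itv01 c0 c1)); exact: mem_set.
rewrite (_ : conv c u v = (1 - c%:num) *: v + c%:num *: u); last exact: addrC.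
by apply/mem_set/cA => //; rewrite ge0 le1.
Qed.

Lemma convex_set_preimage (R : numDomainType) (M N : lmodType R)
    (f : {linear M -> N}) (A : set N) :
  convex_set A -> convex_set (f @^-1` A).
Proof.
move=> /convex_setP cA; apply/convex_setP => u v c c01 Au Av.
by rewrite /= linearD !linearZZ; exact: cA.
Qed.

Section ConvexHull.
Variable R : realType.
Implicit Types (ps : seq (pt3 R)) (u v z : pt3 R) (w : nat -> R).

Definition point ps i : pt3 R := nth (north R) ps i.

Lemma hull3P ps z : hull3 ps z <->
  exists2 w, weights (size ps) w & z = \sum_(i < size ps) w i *: point ps i.
Proof.
have sumE n w (q : nat -> pt3 R) :
    (\sum_(i < n) w i * (q i).1.1, \sum_(i < n) w i * (q i).1.2,
     \sum_(i < n) w i * (q i).2) = \sum_(i < n) w i *: q i.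
  by elim: n => [|n IHn]; rewrite ?big_ord0// !big_ord_recr /= -IHn.
by split=> [[w [w0 [w1 ->]]]|[w [w0 w1] ->]]; exists w.
Qed.

Lemma hull3_convex ps : convex_set (hull3 ps).
Proof.
apply/convex_setP => u v c /andP[c0 c1].
move=> /hull3P[w [w0 w1] ->] /hull3P[w' [w'0 w'1] ->].
apply/hull3P; exists (fun i => (1 - c) * w i + c * w' i).
  split=> [i|]; first by rewrite addr_ge0// mulr_ge0// subr_ge0.
  by rewrite big_split /= -!mulr_sumr w1 w'1; ring.
rewrite !scaler_sumr -big_split; apply: eq_bigr => i _ /=.
by rewrite [RHS]scalerDl !scalerA.
Qed.

Lemma hull3_mem ps u : u \in ps -> hull3 ps u.
Proof.
move=> u_ps; have lt_i : (index u ps < size ps)%N by rewrite index_mem.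
apply/hull3P; exists (fun i => (i == index u ps)%:R).
  split=> [i|]; first exact: ler0n.
  rewrite (bigD1 (Ordinal lt_i))//= eqxx big1 ?addr0// => i.
  by rewrite -val_eqE /= => /negPf ->.
rewrite (bigD1 (Ordinal lt_i))//= eqxx scale1r big1 ?addr0 => [|i].
  by rewrite /point nth_index.
by rewrite -val_eqE /= => /negPf ->; rewrite scale0r.
Qed.

Lemma hull3_dot_le ps u z M : {in ps, forall q, dot3 u q <= M} ->
  hull3 ps z -> dot3 u z <= M.
Proof.
move=> psM /hull3P[w ww ->]; rewrite dot3_sumr.
apply: (weighted_mean_le (f := fun i => dot3 u (point ps i))) => // i i_lt.
exact/psM/mem_nth.
Qed.

Lemma hull3_unit_ball ps z : {in ps, forall u, dot3 u u <= 1} ->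
  hull3 ps z -> dot3 z z <= 1.
Proof.
move=> ps1 psz; suff : dot3 z z <= (1 + dot3 z z) / 2 by lra.
apply: hull3_dot_le psz => u /ps1 u1.
by have := dot3_ge0 (u - z); rewrite dot3Bl !dot3Br (dot3C z u); lra.
Qed.

End ConvexHull.

Section Thickening.
Variable R : realType.
Implicit Types (S : set (pt3 R)) (d x y s t : R) (u v : pt3 R).

Definition thickening S d : set (pt3 R) :=
  [set u | exists2 z, S z & dist3 u z <= d].

Lemma thickeningS S d d' : d <= d' -> thickening S d `<=` thickening S d'.
Proof. by move=> dd' u [z Sz uz]; exists z => //; exact: le_trans dd'. Qed.

Lemma thickening_preimage (f : {linear pt3 R -> pt3 R}) S d u :
  (forall v, dot3 (f v) (f v) = dot3 v v) ->
  thickening (f @^-1` S) d u -> thickening S d (f u).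
Proof.
by move=> f_isom [z Sz uz]; exists (f z) => //; rewrite dist3_isometry.
Qed.

Definition flip s t v : pt3 R := (s * v.1.1, t * v.1.2, v.2).

Lemma flip_is_linear s t : linear (flip s t).
Proof.
by move=> c u v; rewrite /flip !scale3E; congr (_, _, _) => /=; ring.
Qed.

HB.instance Definition _ s t :=
  GRing.isLinear.Build R (pt3 R) (pt3 R) _ (flip s t) (flip_is_linear s t).

Lemma dot3_flip s t v : s ^+ 2 = 1 -> t ^+ 2 = 1 ->
  dot3 (flip s t v) (flip s t v) = dot3 v v.
Proof.
by move=> s1 t1; rewrite /dot3 /flip /= -!expr2 !exprMn s1 t1 !mul1r.
Qed.

Lemma hat_flip s t x y : s ^+ 2 = 1 -> t ^+ 2 = 1 ->
  hat (s * x, t * y) = flip s t (hat (x, y)).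
Proof.
move=> s1 t1; rewrite /hat /flip /= !exprMn s1 t1 !mul1r.
by rewrite !mulrA !(mulrC 2).
Qed.

Definition swap v : pt3 R := (v.1.2, v.1.1, v.2).

Lemma swap_is_linear : linear swap.
Proof. by []. Qed.

HB.instance Definition _ :=
  GRing.isLinear.Build R (pt3 R) (pt3 R) _ swap swap_is_linear.

Lemma dot3_swap v : dot3 (swap v) (swap v) = dot3 v v.
Proof. by rewrite /dot3 /swap /=; ring. Qed.

Lemma hat_swap x y : hat (y, x) = swap (hat (x, y)).
Proof. by rewrite /hat /swap /= addrAC. Qed.

End Thickening.

(** * Stereographic projection *)

Section StereographicProjection.
Variable R : realType.
Implicit Types (c d h t x y : R) (p q : pt2 R) (u : pt3 R) (S : set (pt3 R)).

Definition sqn1 p : R := 1 + p.1 ^+ 2 + p.2 ^+ 2.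

Definition sqd2 p q : R := (p.1 - q.1) ^+ 2 + (p.2 - q.2) ^+ 2.

Lemma sqn1_gt0 p : 0 < sqn1 p.
Proof. by rewrite /sqn1 -addrA ltr_pwDl// addr_ge0// sqr_ge0. Qed.

Lemma sqn1_neq0 p : sqn1 p != 0.
Proof. by rewrite gt_eqF ?sqn1_gt0. Qed.

Lemma dot3_hat p : dot3 (hat p) (hat p) = 1.
Proof.
by have := sqn1_neq0 p; rewrite /dot3 /hat /sqn1 /= => p_neq0; field.
Qed.

Lemma dot3_north : dot3 (north R) (north R) = 1.
Proof. by rewrite /dot3 /=; ring. Qed.

Lemma dot3_hat_north p : dot3 (hat p) (north R) = 1 - 2 / sqn1 p.
Proof. by rewrite /dot3 /= !mulr0 !add0r mulr1. Qed.

Lemma sqr_dist3_hat p q :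
  dist3 (hat p) (hat q) ^+ 2 = 4 * sqd2 p q / (sqn1 p * sqn1 q).
Proof.
rewrite dist3E sqr_norm3 /dot3 /hat /sqd2 /=.
have := sqn1_neq0 p; have := sqn1_neq0 q; rewrite /sqn1 => q_neq0 p_neq0.
by field; rewrite p_neq0 q_neq0.
Qed.

Lemma dot3_hat2 p q :
  dot3 (hat p) (hat q) = 1 - 2 * sqd2 p q / (sqn1 p * sqn1 q).
Proof.
have := sqr_dist3_hat p q; rewrite sqr_dist3 !dot3_hat -!mulrA.
by move: (sqd2 p q * _) => z; lra.
Qed.

Lemma dist3_hat_acuteE p q q' :
  (dist3 (hat p) (hat q') ^+ 2 <=
     dist3 (hat p) (hat q) ^+ 2 + dist3 (hat q) (hat q') ^+ 2) =
  (sqd2 p q' * sqn1 q <= sqd2 p q * sqn1 q' + sqd2 q q' * sqn1 p).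
Proof.
have k0 : 0 < 4 / (sqn1 p * sqn1 q * sqn1 q').
  by rewrite !(divr_gt0, mulr_gt0) ?sqn1_gt0.
rewrite -[RHS](ler_pM2r k0) !sqr_dist3_hat.
by congr (_ <= _); field; rewrite !sqn1_neq0.
Qed.

Lemma hat_comb p q q' x y :
  p.1 = x * q.1 + y * q'.1 -> p.2 = x * q.2 + y * q'.2 ->
  let t := x * sqn1 q + y * sqn1 q' - sqn1 p - 2 * (x + y - 1) in
  hat p = (x * sqn1 q / sqn1 p) *: hat q + (y * sqn1 q' / sqn1 p) *: hat q'
          - (t / sqn1 p) *: north R.
Proof.
move=> p1 p2 t; have p_neq0 := sqn1_neq0 p.
have q_neq0 := sqn1_neq0 q; have q'_neq0 := sqn1_neq0 q'.
rewrite /hat !scale3E /= -!/(sqn1 _) /t; congr (_, _, _) => /=.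
- by rewrite p1; field; rewrite p_neq0 q_neq0 q'_neq0.
- by rewrite p2; field; rewrite p_neq0 q_neq0 q'_neq0.
- by field; rewrite p_neq0 q_neq0 q'_neq0.
Qed.

Lemma dot3_hat_edge p q (e := hat q - hat p) (r := sqn1 p * sqn1 q) :
  [/\ dot3 e e = 4 * sqd2 p q / r, dot3 e (hat p) = - (2 * sqd2 p q / r) &
      dot3 e (north R) = 2 / sqn1 p - 2 / sqn1 q].
Proof.
split.
- by rewrite dot3Bl !dot3Br !dot3_hat (dot3C (hat q)) dot3_hat2 -/r; lra.
- by rewrite dot3Bl (dot3C (hat q)) dot3_hat dot3_hat2 -/r; ring.
- by rewrite dot3Bl !dot3_hat_north; ring.
Qed.

(* The second formula is Heron's, for the height of the triangle with vertices
   [hat p], [hat q] and the pole. *)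
Lemma reject_north_hat_edge p q
    (v := reject (hat q - hat p) (hat p - north R)) :
  sqd2 p q != 0 ->
  dot3 (hat p) v = (sqn1 p + sqn1 q - sqd2 p q) / (sqn1 p * sqn1 q) /\
  norm3 v ^+ 2 =
    (4 * sqd2 p q * sqn1 q - (sqn1 p - sqn1 q - sqd2 p q) ^+ 2)
    / (sqd2 p q * (sqn1 p * sqn1 q)).
Proof.
move=> pq_neq0; have p_neq0 := sqn1_neq0 p; have q_neq0 := sqn1_neq0 q.
have [ee ep en] := dot3_hat_edge p q.
have e_neq0 : dot3 (hat q - hat p) (hat q - hat p) != 0.
  by rewrite ee !(mulf_neq0, invr_neq0)// pnatr_eq0.
have pv : dot3 (hat p) v = (sqn1 p + sqn1 q - sqd2 p q) / (sqn1 p * sqn1 q).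
  rewrite dot3_rejectr !(dot3Br _ (hat p) (north R)) ee ep en.
  by rewrite dot3_hat dot3_hat_north; field; rewrite pq_neq0 p_neq0 q_neq0.
split=> //; rewrite sqr_norm3 dot3_reject// dot3Bl pv dot3_rejectr.
rewrite !(dot3Br _ (hat p) (north R)) ee ep en (dot3C (north R)).
by rewrite dot3_north dot3_hat_north; field; rewrite pq_neq0 p_neq0 q_neq0.
Qed.

Lemma reject_north_vertical_edge x y y' (a := hat (x, y)) (b := hat (x, y')) :
  y != y' -> 0 <= y * y' -> 1 + x ^+ 2 + (y' - y) ^+ 2 <= 4 ->
  norm3 (reject (b - a) (a - north R)) <=
  2 * dot3 a (reject (b - a) (a - north R)).
Proof.
move=> yy' yy'0 small; set v := reject _ _.
pose r := sqn1 (x, y) * sqn1 (x, y').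
have r0 : 0 < r by rewrite mulr_gt0 ?sqn1_gt0.
have sqd : sqd2 (x, y) (x, y') = (y' - y) ^+ 2 by rewrite /sqd2 /=; ring.
have sqd_neq0 : (y' - y) ^+ 2 != 0 by rewrite sqrf_eq0 subr_eq0 eq_sym.
have [av vv] : dot3 a v = 2 * (1 + x ^+ 2 + y * y') / r /\
    norm3 v ^+ 2 = 4 * (1 + x ^+ 2) / r.
  have := @reject_north_hat_edge (x, y) (x, y').
  rewrite -/v sqd => /(_ sqd_neq0)[-> ->]; split; rewrite -/r.
    by congr (_ / _); rewrite /sqn1 /=; ring.
  have -> : 4 * (y' - y) ^+ 2 * sqn1 (x, y') -
      (sqn1 (x, y) - sqn1 (x, y') - (y' - y) ^+ 2) ^+ 2
    = (y' - y) ^+ 2 * (4 * (1 + x ^+ 2)) by rewrite /sqn1 /=; ring.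
  by rewrite -mulf_div divff// mul1r.
have x2 := sqr_ge0 x.
rewrite -(@ler_pXn2r _ 2)// ?nnegrE ?norm3_ge0//; last first.
  by rewrite av mulr_ge0// divr_ge0 ?(ltW r0)//; lra.
rewrite vv av -subr_ge0.
have -> : (2 * (2 * (1 + x ^+ 2 + y * y') / r)) ^+ 2 - 4 * (1 + x ^+ 2) / r
  = 4 * (4 * (1 + x ^+ 2 + y * y') ^+ 2 - (1 + x ^+ 2) * r) / r ^+ 2.
  by field; rewrite gt_eqF.
rewrite divr_ge0 ?sqr_ge0// mulr_ge0//.
have -> : r = (1 + x ^+ 2 + y * y') ^+ 2 + (1 + x ^+ 2) * (y' - y) ^+ 2.
  by rewrite /r /sqn1 /=; ring.
have H0 : 0 < 1 + x ^+ 2 by lra.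
move: (1 + x ^+ 2) H0 small => H H0 small.
have : H ^+ 2 <= (H + y * y') ^+ 2 by rewrite lerXn2r ?nnegrE//; lra.
by have := sqr_ge0 H; have := sqr_ge0 (y' - y); nra.
Qed.

Lemma vertical_edge_acute x0 y0 y1 x y (u := hat (x, y)) (a := hat (x0, y0))
    (b := hat (x0, y1)) :
  0 <= x0 <= x -> 0 <= y0 <= y -> y <= y1 -> (x - x0) ^+ 2 <= y1 - y ->
  dist3 u b ^+ 2 <= dist3 u a ^+ 2 + dist3 a b ^+ 2 /\
  dist3 u a ^+ 2 <= dist3 u b ^+ 2 + dist3 a b ^+ 2.
Proof.
move=> /andP[x00 x0x] /andP[y00 y0y] yy1 near_edge.
rewrite [in X in _ /\ X](dist3C a b) !dist3_hat_acuteE /sqd2 /sqn1 /= !subrr.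
split.
  have y_sq : (y - y1) ^+ 2 <= (y0 - y1) ^+ 2 by nra.
  have x_sq : (x - x0) ^+ 2 * (1 + x0 ^+ 2 + y0 ^+ 2) <=
      (x - x0) ^+ 2 * (1 + x0 ^+ 2 + y1 ^+ 2).
    by rewrite ler_wpM2l ?sqr_ge0//; nra.
  have : (y - y1) ^+ 2 * (1 + x0 ^+ 2 + y0 ^+ 2) <=
      (y0 - y1) ^+ 2 * (1 + x ^+ 2 + y ^+ 2).
    by rewrite ler_pM ?sqr_ge0//; nra.
  have : 0 <= (y - y0) ^+ 2 * (1 + x0 ^+ 2 + y1 ^+ 2).
    by rewrite mulr_ge0 ?sqr_ge0//; nra.
  lra.
have b_far : 0 <= (y1 - y) * (1 + x0 ^+ 2 + y0 ^+ 2 - 2 * y0).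
  by rewrite mulr_ge0 ?subr_ge0//; have := sqr_ge0 (y0 - 1); nra.
have x_close : 0 <= y0 * (y1 - y - (x - x0) ^+ 2).
  by rewrite mulr_ge0 ?subr_ge0.
have : 0 <= y0 * (y1 - y) by rewrite mulr_ge0 ?subr_ge0.
have : 0 <= (y1 - y0) * x0 * (x - x0) by rewrite !mulr_ge0 ?subr_ge0//; lra.
have : 0 <= y0 * (y - y0) * (y1 - y) by rewrite !mulr_ge0 ?subr_ge0.
move=> ? ? ?.
suff : 0 <= 2 * (y1 - y0) * ((y1 - y) * (1 + x0 ^+ 2 + y0 ^+ 2)
    + (y1 - y0) * x0 * (x - x0) + y0 * (y - y0) * (y1 - y)
    - y0 * (x - x0) ^+ 2) by lra.
by rewrite mulr_ge0//; lra.
Qed.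

Lemma chi_ge0 D d : 0 < D -> 0 <= chi D d.
Proof.
move=> /ltW D0; rewrite /chi addr_ge0// divr_ge0 ?exprn_even_ge0//.
  by rewrite mulr_ge0.
by rewrite mulr_ge0 ?exprn_ge0.
Qed.

Lemma chi1_ge d d' : 0 <= d <= d' -> d ^+ 2 / 4 <= chi 1 d'.
Proof.
move=> /andP[d0 dd']; rewrite /chi !expr1n !mulr1 ler_wpDr//.
  by rewrite divr_ge0 ?exprn_even_ge0.
by rewrite ler_pM2r ?invr_gt0// lerXn2r ?nnegrE// (le_trans d0).
Qed.

Lemma cap_height_le_chi2 h d : 0 <= h <= 1 -> 1 - d ^+ 2 / 4 <= h ^+ 2 ->
  1 - h <= chi 2 d.
Proof.
move=> /andP[h0 h1] hd.
have -> : chi 2 d = (d ^+ 2 / 4) / 2 + (d ^+ 2 / 4) ^+ 2 by rewrite /chi; field.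
move: (d ^+ 2 / 4) hd => t ht.
have h2 : h ^+ 2 <= h by rewrite expr2 ler_piMl.
have h3 : h ^+ 3 <= h by rewrite exprS ler_piMr// (le_trans h2).
have : (1 - h ^+ 2) ^+ 2 <= t ^+ 2 by rewrite lerXn2r ?nnegrE//; lra.
have : 0 <= (1 - h) * (1 / 2 + 3 / 2 * h - h ^+ 2 - h ^+ 3).
  by apply: mulr_ge0; lra.
lra.
Qed.

Lemma dist3_scale_le_chi2 u h d : dot3 u u = 1 -> 0 <= h <= 1 ->
  1 - d ^+ 2 / 4 <= h ^+ 2 -> dist3 u (h *: u) <= chi 2 d.
Proof.
move=> u1 h01 hd; have /andP[h0 h1] := h01.
rewrite dist3E -{1}(scale1r u) -scalerBl norm3Z ?subr_ge0//.
by rewrite /norm3 u1 sqrtr1 mulr1 cap_height_le_chi2.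
Qed.

(* The projective map taking the solid paraboloid [x ^+ 2 + y ^+ 2 <= t] to the
   unit ball. *)
Definition ball_chart x y t : pt3 R :=
  (2 * x / (1 + t), 2 * y / (1 + t), 1 - 2 / (1 + t)).

Lemma hat_ball_chart x y : hat (x, y) = ball_chart x y (x ^+ 2 + y ^+ 2).
Proof. by rewrite /hat /ball_chart /= addrA. Qed.

Lemma convex_set_ball_chart S x y t x' y' t' c : convex_set S ->
  0 <= c <= 1 -> 0 < 1 + t -> 0 < 1 + t' ->
  S (ball_chart x y t) -> S (ball_chart x' y' t') ->
  S (ball_chart ((1 - c) * x + c * x') ((1 - c) * y + c * y')
                ((1 - c) * t + c * t')).
Proof.
move=> /convex_setP cS /andP[c0 c1] t0 t'0 Sx Sx'.
pose D := (1 - c) * (1 + t) + c * (1 + t').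
have DE : 1 + ((1 - c) * t + c * t') = D by rewrite /D; ring.
have D0 : 0 < D.
  move: c0; rewrite /D le_eqVlt => /predU1P[<-|c0]; first by lra.
  by rewrite ltr_wpDl ?mulr_ge0 ?mulr_gt0 ?subr_ge0// ltW.
have w01 : 0 <= c * (1 + t') / D <= 1.
  rewrite divr_ge0 ?mulr_ge0 ?(ltW t'0) ?(ltW D0)//= ler_pdivrMr// mul1r.
  by rewrite lerDr mulr_ge0 ?subr_ge0// ltW.
have [D_neq0 t_neq0 t'_neq0] : [/\ D != 0, 1 + t != 0 & 1 + t' != 0].
  by rewrite !gt_eqF.
have := cS _ _ _ w01 Sx Sx'; congr S; rewrite /ball_chart !scale3E DE.
by congr (_, _, _) => /=; rewrite /D in D_neq0 *; field; apply/and3P.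
Qed.

End StereographicProjection.

(** * Images of rectangles *)

Lemma conv_itv (R : realFieldType) (x0 x1 x : R) : x0 <= x <= x1 ->
  exists2 c, 0 <= c <= 1 & x = (1 - c) * x0 + c * x1.
Proof.
move=> /andP[x0x xx1].
have [x0_eq_x1|x0_neq_x1] := eqVneq x0 x1.
  exists 0; first by rewrite lexx ler01.
  rewrite subr0 mul1r mul0r addr0; apply/le_anti.
  by rewrite x0x {1}x0_eq_x1 xx1.
have w0 : 0 < x1 - x0 by rewrite subr_gt0 lt_neqAle x0_neq_x1 (le_trans x0x).
exists ((x - x0) / (x1 - x0)); last by field; rewrite gt_eqF.
by rewrite ler_pdivlMr// ler_pdivrMr// mul0r mul1r subr_ge0 lerD2r x0x.
Qed.

Section Rectangle.
Variables (R : realType) (x0 x1 y0 y1 : R).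
Implicit Types (S : set (pt3 R)) (d x y : R).

Definition corner_dot : R := x0 * x1 + y0 * y1.

Definition sqr_diagonal : R := (x1 - x0) ^+ 2 + (y1 - y0) ^+ 2.

(* The opposite of the power of [(x, y)] with respect to the circumscribed
   circle. *)
Definition circle_power x y : R := (x - x0) * (x1 - x) + (y - y0) * (y1 - y).

Definition corners_in S :=
  {in [:: x0; x1] & [:: y0; y1], forall x y, S (hat (x, y))}.

(* The line from the origin to [hat (x, y)] meets the plane of the images of the
   corners beyond the image of the edge with abscissa [x0]. *)
Definition beyond_left_edge x y :=
  [/\ 0 <= x0, 0 <= y0, x0 <= x <= x1, y0 <= y <= y1 &
      (x - x0) * (1 + corner_dot) < circle_power x y * x0].

Lemma circle_power_ge0 x y : x0 <= x <= x1 -> y0 <= y <= y1 ->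
  0 <= circle_power x y.
Proof.
by move=> /andP[? ?] /andP[? ?]; rewrite addr_ge0// mulr_ge0// subr_ge0.
Qed.

(* The points [(xi, yj, xi ^+ 2 + yj ^+ 2)] are coplanar. *)
Lemma convex_set_rectangle S x y : convex_set S -> corners_in S ->
  x0 <= x <= x1 -> y0 <= y <= y1 ->
  S (ball_chart x y ((x0 + x1) * x + (y0 + y1) * y - corner_dot)).
Proof.
move=> cS corner /conv_itv[c c01 ->] /conv_itv[c' c'01 ->].
have lift_gt0 z z' : 0 < 1 + (z ^+ 2 + z' ^+ 2) :> R.
  by rewrite ltr_pwDl// addr_ge0 ?sqr_ge0.
have edge_gt0 z :
    0 < 1 + ((1 - c) * (x0 ^+ 2 + z ^+ 2) + c * (x1 ^+ 2 + z ^+ 2)).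
  have /andP[c0 c1] := c01.
  by rewrite ltr_pwDl// addr_ge0// mulr_ge0 ?subr_ge0 ?addr_ge0 ?sqr_ge0.
have S_edge z : z \in [:: y0; y1] ->
    S (ball_chart ((1 - c) * x0 + c * x1) ((1 - c) * z + c * z)
      ((1 - c) * (x0 ^+ 2 + z ^+ 2) + c * (x1 ^+ 2 + z ^+ 2))).
  move=> zy; apply: convex_set_ball_chart => //; rewrite -hat_ball_chart;
    by apply: corner; rewrite // !inE eqxx ?orbT.
have := convex_set_ball_chart cS c'01 (edge_gt0 _) (edge_gt0 _)
  (S_edge y0 _) (S_edge y1 _).
rewrite !inE !eqxx orbT => /(_ isT isT).
by congr (S (ball_chart _ _ _)); rewrite /corner_dot; ring.
Qed.

Section RadialProjection.
Variables x y : R.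
Let u := hat (x, y).
Let r := sqn1 (x, y).
Let K := corner_dot.
Let G := circle_power x y.
Let c := (1 + K) / (1 + K + G).
Let h := (1 + K) * r / ((1 + K) * r + 2 * G).

Lemma ball_chart_radial : 0 < 1 + K -> 0 <= G ->
  ball_chart (c * x) (c * y) ((x0 + x1) * (c * x) + (y0 + y1) * (c * y) - K)
  = h *: u.
Proof.
move=> K0 G0; have r0 : 0 < r := sqn1_gt0 _.
have KG0 : 0 < 1 + K + G by rewrite ltr_wpDr.
have D0 : 0 < (1 + K) * r + 2 * G.
  by apply: ltr_wpDr; [exact: mulr_ge0|exact: mulr_gt0].
have [KG_neq0 D_neq0] := (lt0r_neq0 KG0, lt0r_neq0 D0).
have tE : 1 + ((x0 + x1) * (c * x) + (y0 + y1) * (c * y) - K)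
    = ((1 + K) * r + 2 * G) / (1 + K + G).
  move: KG_neq0; rewrite /c /r /sqn1 /K /G /corner_dot /circle_power /= => ?.
  by field.
rewrite /ball_chart tE /u /hat scale3E /= -/(sqn1 (x, y)) -/r /c /h.
by congr (_, _, _); field; rewrite ?KG_neq0 ?D_neq0 ?gt_eqF.
Qed.

Lemma radial_sqr_ge : 0 < 1 + K -> 0 <= G ->
  1 - sqr_diagonal / ((1 + K) ^+ 2 + sqr_diagonal) <= h ^+ 2.
Proof.
move=> K0 G0; have r0 : 0 < r := sqn1_gt0 _; set w := sqr_diagonal.
have w0 : 0 <= w by rewrite addr_ge0 ?sqr_ge0.
pose n : pt3 R := (x0 + x1, y0 + y1, K - 1).
have nn : dot3 n n = (1 + K) ^+ 2 + w.
  by rewrite /dot3 /n /w /K /sqr_diagonal /corner_dot /=; ring.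
have D0 : 0 < (1 + K) * r + 2 * G.
  by apply: ltr_wpDr; [exact: mulr_ge0|exact: mulr_gt0].
have un : dot3 u n = ((1 + K) * r + 2 * G) / r.
  rewrite /u /n /dot3 /hat /K /G /r /corner_dot /circle_power /sqn1 /=.
  by have := lt0r_neq0 r0; rewrite /r /sqn1 /= => ?; field.
have nn0 : 0 < (1 + K) ^+ 2 + w by rewrite ltr_pwDl// exprn_gt0.
have -> : 1 - w / ((1 + K) ^+ 2 + w) = (1 + K) ^+ 2 / ((1 + K) ^+ 2 + w).
  by field; rewrite gt_eqF.
have := sqr_dot3_le u n; rewrite dot3_hat mul1r un nn => un_le.
rewrite ler_pdivrMr//; apply: le_trans (ler_wpM2l (sqr_ge0 h) un_le).
by rewrite -exprMn /h mulrA divfK ?mulfK ?gt_eqF.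
Qed.

Lemma thickening_radial S d : convex_set S -> corners_in S ->
  x0 <= x <= x1 -> y0 <= y <= y1 -> 0 < 1 + K ->
  x0 * (1 + K + G) <= x * (1 + K) <= x1 * (1 + K + G) ->
  y0 * (1 + K + G) <= y * (1 + K) <= y1 * (1 + K + G) ->
  4 * sqr_diagonal / ((1 + K) ^+ 2 + sqr_diagonal) <= d ^+ 2 ->
  thickening S (chi 2 d) u.
Proof.
move=> cS corner x_itv y_itv K0 x_in y_in d_ge.
have G0 := circle_power_ge0 x_itv y_itv; have r0 : 0 < r := sqn1_gt0 _.
have KG0 : 0 < 1 + K + G by rewrite ltr_wpDr.
have scaled z z0 z1 : z0 * (1 + K + G) <= z * (1 + K) <= z1 * (1 + K + G) ->
    z0 <= c * z <= z1.
  by rewrite [c * z]mulrAC ler_pdivlMr// ler_pdivrMr// (mulrC _ z).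
have := convex_set_rectangle cS corner (scaled _ _ _ x_in) (scaled _ _ _ y_in).
rewrite (ball_chart_radial K0 G0) => S_radial; exists (h *: u) => //.
have D0 : 0 < (1 + K) * r + 2 * G.
  by apply: ltr_wpDr; [exact: mulr_ge0|exact: mulr_gt0].
apply: dist3_scale_le_chi2; first exact: dot3_hat.
  rewrite divr_ge0 ?mulr_ge0 ?(ltW K0) ?(ltW r0) ?(ltW D0)//=.
  by rewrite ler_pdivrMr// mul1r lerDl mulr_ge0.
by apply: le_trans (radial_sqr_ge K0 G0); lra.
Qed.

End RadialProjection.

Section BeyondLeftEdge.
Variables x y : R.
Let a := hat (x0, y0).
Let b := hat (x0, y1).
Let u := hat (x, y).
Hypothesis beyond : beyond_left_edge x y.

Lemma beyond_left_edge_gt0 : 0 < x0.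
Proof.
have [x0_ge0 y0_ge0 /andP[x0x xx1] /andP[y0y yy1] xG] := beyond.
have [x1_ge0 y1_ge0] : 0 <= x1 /\ 0 <= y1 by split; lra.
have : 0 <= (x - x0) * (1 + corner_dot).
  by rewrite mulr_ge0 ?subr_ge0// !addr_ge0 ?mulr_ge0.
rewrite lt_neqAle x0_ge0 andbT eq_sym => lhs_ge0; apply/eqP => x0_eq0.
by move: xG; rewrite ltNge {1}x0_eq0 mulr0 lhs_ge0.
Qed.

Lemma beyond_left_edge_close : x1 - x0 <= 1 / 2 ->
  3 / 2 * (x - x0) < (y - y0) * (y1 - y).
Proof.
move=> width; have x0_gt0 := beyond_left_edge_gt0.
have [x0_ge0 y0_ge0 /andP[x0x xx1] /andP[y0y yy1] xG] := beyond.
have K_ge : 2 * x0 <= 1 + corner_dot.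
  by rewrite /corner_dot; have := sqr_ge0 (x0 - 1); nra.
have : 2 * (x - x0) < circle_power x y.
  rewrite -(ltr_pM2r x0_gt0); apply: le_lt_trans xG.
  by have := ler_wpM2l (_ : 0 <= x - x0) K_ge; lra.
have : (x - x0) * (x1 - x) <= (x - x0) * (1 / 2) by rewrite ler_wpM2l; lra.
by rewrite /circle_power; lra.
Qed.

Lemma beyond_left_edge_comb : y0 < y1 -> exists wa wb t,
  [/\ u = wa *: a + wb *: b - t *: north R, 0 <= t & 1 + t <= wa + wb].
Proof.
move=> y0y1; have x0_gt0 := beyond_left_edge_gt0.
have [_ _ /andP[x0x _] _ xG] := beyond; set G := circle_power x y in xG.
have [x0_neq0 y0y1_neq0] : x0 != 0 /\ y1 - y0 != 0.
  by rewrite !gt_eqF ?subr_gt0.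
have r0 := sqn1_gt0 (x, y); have r_neq0 := sqn1_neq0 (x, y).
pose cb := (y - y0 * x / x0) / (y1 - y0); pose ca := x / x0 - cb.
have tE : ca * sqn1 (x0, y0) + cb * sqn1 (x0, y1) - sqn1 (x, y)
    - 2 * (ca + cb - 1) = (G * x0 - (x - x0) * (1 + corner_dot)) / x0.
  rewrite /ca /cb /sqn1 /G /circle_power /corner_dot /=.
  by field; rewrite x0_neq0.
exists (ca * sqn1 (x0, y0) / sqn1 (x, y)), (cb * sqn1 (x0, y1) / sqn1 (x, y)),
  ((G * x0 - (x - x0) * (1 + corner_dot)) / x0 / sqn1 (x, y)).
split.
- rewrite -tE; apply: hat_comb; rewrite /ca /cb /=;
    by field; rewrite ?x0_neq0 y0y1_neq0.
- by rewrite divr_ge0 ?divr_ge0 ?subr_ge0// ltW.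
- rewrite -tE -subr_ge0; set s := _ - _.
  have -> : s = 2 * (x - x0) / x0 / sqn1 (x, y).
    by rewrite /s /ca; field; rewrite x0_neq0 r_neq0.
  by rewrite divr_ge0 ?divr_ge0 ?mulr_ge0 ?subr_ge0// ltW.
Qed.

Lemma beyond_left_edge_dist :
  x1 <= 3 / 2 -> x1 - x0 <= 1 / 2 -> y1 - y0 <= 1 / 2 ->
  exists2 s, 0 <= s <= 1 &
    dist3 u ((1 - s) *: a + s *: b) <= dist3 a b ^+ 2 / 4.
Proof.
move=> x1_le x1x0_le y1y0_le; have close := beyond_left_edge_close x1x0_le.
have [x0_ge0 y0_ge0 /andP[x0x xx1] /andP[y0y yy1] _] := beyond.
have y0y1 : y0 < y1 by rewrite ltNge; apply/negP => y1y0; nra.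
have [wa [wb [t [uE t_ge0 t_le]]]] := beyond_left_edge_comb y0y1.
have [acute_a acute_b] : dist3 u b ^+ 2 <= dist3 u a ^+ 2 + dist3 a b ^+ 2 /\
    dist3 u a ^+ 2 <= dist3 u b ^+ 2 + dist3 a b ^+ 2.
  by apply: vertical_edge_acute; nra.
apply: dist3_edge_le uE t_ge0 t_le acute_a acute_b _; try exact: dot3_hat.
  have -> : dist3 a b ^+ 2
      = 4 * (y1 - y0) ^+ 2 / (sqn1 (x0, y0) * sqn1 (x0, y1)).
    by rewrite sqr_dist3_hat; congr (4 * _ / _); rewrite /sqd2 /=; ring.
  have den : 1 <= sqn1 (x0, y0) * sqn1 (x0, y1).
    by rewrite mulr_ege1// /sqn1 /=; nra.
  apply/andP; split.
    by rewrite divr_gt0 ?mulr_gt0 ?exprn_gt0 ?sqn1_gt0 ?subr_gt0.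
  by rewrite ler_pdivrMr ?mulr_gt0 ?sqn1_gt0//; nra.
apply: reject_north_vertical_edge; first by rewrite lt_eqF.
  by rewrite mulr_ge0//; lra.
by nra.
Qed.

Lemma thickening_beyond_left_edge S d : convex_set S -> S a -> S b ->
  x1 <= 3 / 2 -> x1 - x0 <= 1 / 2 -> y1 - y0 <= 1 / 2 -> dist3 a b <= d ->
  thickening S (chi 1 d) u.
Proof.
move=> /convex_setP cS Sa Sb x1_le x1x0 y1y0 d_ge.
have [s s01 dist_le] := beyond_left_edge_dist x1_le x1x0 y1y0.
exists ((1 - s) *: a + s *: b); first exact: cS.
by apply: le_trans dist_le (chi1_ge _); rewrite dist3_ge0.
Qed.

End BeyondLeftEdge.
End Rectangle.

Section SmallRectangle.
Variable R : realType.
Implicit Types (S : set (pt3 R)) (d x y z : R).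

Lemma thickening_quadrant_rectangle S x0 x1 y0 y1 x y d1 d2
    (K := corner_dot x0 x1 y0 y1) (w := sqr_diagonal x0 x1 y0 y1) :
  convex_set S -> corners_in x0 x1 y0 y1 S ->
  0 <= x0 -> 0 <= y0 -> x1 <= 3 / 2 -> y1 <= 3 / 2 ->
  x1 - x0 <= 1 / 2 -> y1 - y0 <= 1 / 2 -> x0 <= x <= x1 -> y0 <= y <= y1 ->
  dist3 (hat (x0, y0)) (hat (x0, y1)) <= d1 ->
  dist3 (hat (x0, y0)) (hat (x1, y0)) <= d1 ->
  4 * w / ((1 + K) ^+ 2 + w) <= d2 ^+ 2 ->
  thickening S (Num.max (chi 1 d1) (chi 2 d2)) (hat (x, y)).
Proof.
move=> cS corner x0_ge0 y0_ge0 x1_le y1_le x1x0 y1y0 x_itv y_itv.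
move=> left_le bottom_le w_le; set m := Num.max _ _.
have [chi1_le chi2_le] : chi 1 d1 <= m /\ chi 2 d2 <= m.
  by rewrite !le_max !lexx orbT.
pose G := circle_power x0 x1 y0 y1 x y.
have [x_lt|x_ge] := ltP ((x - x0) * (1 + K)) (G * x0).
  apply: (thickeningS chi1_le).
  apply: (thickening_beyond_left_edge _ cS _ _ x1_le x1x0 y1y0 left_le) => //;
    by apply: corner; rewrite !inE eqxx ?orbT.
have [y_lt|y_ge] := ltP ((y - y0) * (1 + K)) (G * y0).
  apply: (thickeningS chi1_le); rewrite hat_swap.
  apply: (thickening_preimage (@dot3_swap R)).
  apply: (thickening_beyond_left_edge _ (convex_set_preimage cS) _ _
    y1_le y1y0 x1x0).
  - split=> //; rewrite /corner_dot /circle_power.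
    by rewrite (addrC (y0 * _)) (addrC ((y - y0) * _)).
  - by rewrite /= -hat_swap; apply: corner; rewrite !inE eqxx.
  - by rewrite /= -hat_swap; apply: corner; rewrite !inE eqxx ?orbT.
  - by rewrite !(hat_swap _ y0) dist3_isometry//; exact: dot3_swap.
have [/andP[x0x xx1] /andP[y0y yy1]] := (x_itv, y_itv).
have [x1_ge0 y1_ge0] : 0 <= x1 /\ 0 <= y1 by split; lra.
have K0 : 0 < 1 + K by rewrite ltr_pwDl// addr_ge0 ?mulr_ge0.
have G0 : 0 <= G by exact: circle_power_ge0.
have scaled z z0 z1 : z <= z1 -> 0 <= z1 -> G * z0 <= (z - z0) * (1 + K) ->
    z0 * (1 + K + G) <= z * (1 + K) <= z1 * (1 + K + G).
  move=> zz1 z1_ge0 z_ge; apply/andP; split; first lra.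
  have : 0 <= (z1 - z) * (1 + K) by rewrite mulr_ge0 ?subr_ge0// ltW.
  by have := mulr_ge0 z1_ge0 G0; lra.
exact: thickeningS chi2_le _ (thickening_radial cS corner x_itv y_itv K0
  (scaled _ _ _ xx1 x1_ge0 x_ge) (scaled _ _ _ yy1 y1_ge0 y_ge) w_le).
Qed.

Definition small_side (z0 z1 : R) :=
  [/\ 0 <= z0 \/ z1 <= 0, - (3 / 2) <= z0, z1 <= 3 / 2 & z1 - z0 <= 1 / 2].

Lemma small_side_reflect z0 z1 z : small_side z0 z1 -> z0 <= z <= z1 ->
  exists s w0 w1,
  [/\ s ^+ 2 = 1, [/\ 0 <= w0, w1 <= 3 / 2 & w1 - w0 <= 1 / 2],
      w0 <= s * z <= w1, {in [:: w0; w1], forall w, s * w \in [:: z0; z1]} &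
      w0 * w1 = z0 * z1 /\ (w1 - w0) ^+ 2 = (z1 - z0) ^+ 2].
Proof.
move=> [[z0_ge0|z1_le0] z0_ge z1_le z1z0] /andP[z0z zz1].
  exists 1, z0, z1; split=> //; first by rewrite expr1n.
    by rewrite mul1r z0z.
  by move=> w; rewrite mul1r.
exists (-1), (- z1), (- z0); split; [by rewrite sqrrN expr1n|split; lra| | |].
- by rewrite mulN1r !lerN2 zz1.
- by move=> w; rewrite mulN1r !inE => /orP[]/eqP->; rewrite opprK eqxx ?orbT.
- by split; ring.
Qed.

Lemma thickening_small_rectangle S x0 x1 y0 y1 x y d1 d2
    (K := corner_dot x0 x1 y0 y1) (w := sqr_diagonal x0 x1 y0 y1) :
  convex_set S -> corners_in x0 x1 y0 y1 S ->
  small_side x0 x1 -> small_side y0 y1 -> x0 <= x <= x1 -> y0 <= y <= y1 ->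
  (forall x' y' z, x' \in [:: x0; x1] -> y' \in [:: y0; y1] ->
     z \in [:: y0; y1] -> dist3 (hat (x', y')) (hat (x', z)) <= d1) ->
  (forall x' y' z, x' \in [:: x0; x1] -> y' \in [:: y0; y1] ->
     z \in [:: x0; x1] -> dist3 (hat (x', y')) (hat (z, y')) <= d1) ->
  4 * w / ((1 + K) ^+ 2 + w) <= d2 ^+ 2 ->
  thickening S (Num.max (chi 1 d1) (chi 2 d2)) (hat (x, y)).
Proof.
move=> cS corner x_small y_small x_itv y_itv vert_le horiz_le w_le.
have [s [u0 [u1 [s1 [u0_ge0 u1_le u1u0] u_itv s_corner [uu u_w]]]]] :=
  small_side_reflect x_small x_itv.
have [t [v0 [v1 [t1 [v0_ge0 v1_le v1v0] v_itv t_corner [vv v_w]]]]] :=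
  small_side_reflect y_small y_itv.
have sK z : s * (s * z) = z by rewrite mulrA -expr2 s1 mul1r.
have tK z : t * (t * z) = z by rewrite mulrA -expr2 t1 mul1r.
have flip_isom p q : dist3 (hat (s * p.1, t * p.2)) (hat (s * q.1, t * q.2))
    = dist3 (hat p) (hat q).
  by rewrite !hat_flip// dist3_isometry// => v; exact: dot3_flip.
rewrite -(sK x) -(tK y) hat_flip//; apply: thickening_preimage.
  by move=> v; exact: dot3_flip.
apply: (@thickening_quadrant_rectangle _ u0 u1 v0 v1) => //.
- exact: convex_set_preimage.
- move=> z z' zu z'v; rewrite /= -hat_flip//.
  by apply: corner; [exact: s_corner|exact: t_corner].
- rewrite -(flip_isom (u0, v0) (u0, v1)).
  by rewrite vert_le ?s_corner ?t_corner ?inE ?eqxx ?orbT.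
- rewrite -(flip_isom (u0, v0) (u1, v0)).
  by rewrite horiz_le ?s_corner ?t_corner ?inE ?eqxx ?orbT.
- by rewrite /corner_dot /sqr_diagonal uu vv u_w v_w.
Qed.

End SmallRectangle.

(** * Cells *)

Section Cells.
Variable R : realType.
Implicit Types (x y z : R) (p q : pt2 R) (u v : pt3 R) (Q : cell).

Lemma maxlist_ge (l : seq R) x : x \in l -> x <= maxlist l.
Proof.
rewrite /maxlist; elim: l (head 0 l) => //= y l IHl h.
by rewrite inE => /predU1P[->|xl]; rewrite le_max ?lexx// IHl// orbT.
Qed.

Lemma minlist_le (l : seq R) x : x \in l -> minlist l <= x.
Proof.
rewrite /minlist; elim: l (head 0 l) => //= y l IHl h.
by rewrite inE => /predU1P[->|xl]; rewrite ge_min ?lexx// IHl// orbT.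
Qed.

Lemma polar_coordinates x y : exists t e1 e2,
  [/\ e1 ^+ 2 + e2 ^+ 2 = 1, x = t * e1 & y = t * e2].
Proof.
pose t := Num.sqrt (x ^+ 2 + y ^+ 2).
have tt : t ^+ 2 = x ^+ 2 + y ^+ 2 by rewrite sqr_sqrtr ?addr_ge0 ?sqr_ge0.
have [t0|t0] := eqVneq t 0.
  move: tt; rewrite t0 expr0n => /esym/eqP; rewrite paddr_eq0 ?sqr_ge0//.
  rewrite !sqrf_eq0 => /andP[/eqP-> /eqP->].
  by exists 0, 1, 0; rewrite !mul0r expr1n expr0n addr0.
exists t, (x / t), (y / t); split; [|by rewrite mulrC divfK..].
by rewrite !expr_div_n -mulrDl -tt divff// expf_neq0.
Qed.

(* The witnesses are the images of the ends of the diameter of the disk on the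
   line through the origin. *)
Lemma diam3_hat_disk_ge (c1 c2 r2 : R) (D : set (pt2 R)) : 0 <= r2 ->
  [set p | (p.1 - c1) ^+ 2 + (p.2 - c2) ^+ 2 <= r2] `<=` D ->
  16 * r2 / ((1 + c1 ^+ 2 + c2 ^+ 2 - r2) ^+ 2 + 4 * r2)
  <= diam3 (@hat R @` D) ^+ 2.
Proof.
move=> r2_ge0 subD; have [t [e1 [e2 [e12 c1E c2E]]]] := polar_coordinates c1 c2.
pose r := Num.sqrt r2; have rr : r ^+ 2 = r2 by rewrite sqr_sqrtr.
pose p z : pt2 R := ((t + z) * e1, (t + z) * e2).
have sqd2_line z z' : sqd2 (p z) (p z') = (z - z') ^+ 2.
  by rewrite -[RHS]mulr1 -e12 /sqd2 /p /=; ring.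
have sqn1_line z : sqn1 (p z) = 1 + (t + z) ^+ 2.
  by rewrite /sqn1 /p /= -[in RHS](mulr1 (_ ^+ 2)) -e12; ring.
have Dp z : z ^+ 2 = r2 -> D (p z).
  move=> zr; apply: subD => /=; rewrite c1E c2E -zr -[leRHS]mulr1 -e12.
  by rewrite le_eqVlt; apply/orP; left; apply/eqP; ring.
have far : dist3 (hat (p r)) (hat (p (- r))) <= diam3 (@hat R @` D).
  apply: dist3_le_diam3.
  - by move=> _ /set_mem[q _ <-]; rewrite dot3_hat.
  - by exists (p r) => //; exact: Dp.
  - by exists (p (- r)) => //; apply: Dp; rewrite sqrrN.
apply: le_trans (_ : dist3 (hat (p r)) (hat (p (- r))) ^+ 2 <= _); last first.
  by rewrite lerXn2r ?nnegrE ?dist3_ge0// (le_trans (dist3_ge0 _ _) far).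
rewrite sqr_dist3_hat sqd2_line !sqn1_line c1E c2E -rr.
have -> : 1 + (t * e1) ^+ 2 + (t * e2) ^+ 2 = 1 + t ^+ 2 * (e1 ^+ 2 + e2 ^+ 2).
  by ring.
by rewrite e12 le_eqVlt; apply/orP; left; apply/eqP; congr (_ / _); ring.
Qed.

Definition approximable Q v := thickening (hull3 (hverts R Q)) (deltaQ R Q) v.

Lemma side_gt0 n : 0 < side R n.
Proof. by rewrite divr_gt0// exprn_gt0. Qed.

Lemma approximable_segment n j p :
  chull (Seg n j) p -> approximable (Seg n j) (hat p).
Proof.
case: p => x y [/= -> x_itv].
set x0 := _ * _ in x_itv; set x1 := _ * _ in x_itv.
have s0 := side_gt0 n.
have x1E : x1 = x0 + side R n by rewrite /x1 -natr1 mulrDl mul1r.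
have x0_ge0 : 0 <= x0 by rewrite mulr_ge0// ltW.
have /andP[x0x xx1] := x_itv.
have [x_ge0 x1_ge0] : 0 <= x /\ 0 <= x1 by split; lra.
have x01_ge0 := mulr_ge0 x0_ge0 x1_ge0.
apply: (@thickening_radial _ x0 x1 0 0); rewrite /corner_dot /circle_power.
- exact: hull3_convex.
- move=> x' y'; rewrite !inE orbb => x'E /eqP->; apply: hull3_mem.
  by move: x'E; rewrite !inE => /orP[]/eqP->; rewrite eqxx ?orbT.
- by [].
- by rewrite lexx.
- by rewrite mul0r addr0; lra.
- rewrite !mul0r subrr mul0r !addr0.
  have : 0 <= (x - x0) * (1 + x * x0).
    by rewrite mulr_ge0 ?subr_ge0// addr_ge0// mulr_ge0.
  have : 0 <= (x1 - x) * (1 + x * x1).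
    by rewrite mulr_ge0 ?subr_ge0// addr_ge0// mulr_ge0.
  by move=> *; apply/andP; split; lra.
- by rewrite !mul0r lexx.
have := @diam3_hat_disk_ge ((j%:R + 1 / 2) * side R n) 0 ((side R n / 2) ^+ 2)
  (@DQ R (Seg n j)) (sqr_ge0 _) (fun _ => id).
apply: le_trans; rewrite le_eqVlt; apply/orP; left; apply/eqP.
by rewrite /sqr_diagonal x1E /x0; congr (_ / _); field.
Qed.

Lemma sq_x0_side n i : side R n <= 1 / 2 ->
  0 <= sq_x0 R n i \/ sq_x0 R n i + side R n <= 0.
Proof.
case: n => [|n]; first by rewrite /side expr0 => h; exfalso; lra.
move=> _; have s0 := side_gt0 n.+1.
have half : (2 ^ n)%:R * side R n.+1 = 2.
  by rewrite /side natrX exprS; field; rewrite expf_neq0.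
rewrite /sq_x0; have [ni|ni] := leqP (2 ^ n) i; [left|right].
  have : (2 ^ n)%:R * side R n.+1 <= i%:R * side R n.+1.
    by rewrite ler_pM2r// ler_nat.
  by rewrite half; lra.
have : i.+1%:R * side R n.+1 <= (2 ^ n)%:R * side R n.+1.
  by rewrite ler_pM2r// ler_nat.
by rewrite half -natr1 mulrDl mul1r; lra.
Qed.

Lemma d1Q_edge_ge Q k (h := hverts R Q) : (k < size h)%N ->
  dist3 (point h k) (point h (k.+1 %% size h)) <= d1Q R Q.
Proof.
by move=> k_lt; apply: maxlist_ge; apply/mapP; exists k; rewrite // mem_iota.
Qed.

Lemma d1Q_square_ge n i j x y z
    (X := [:: sq_x0 R n i; sq_x0 R n i + side R n])
    (Y := [:: sq_x0 R n j; sq_x0 R n j + side R n]) : x \in X -> y \in Y ->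
  (z \in X -> dist3 (hat (x, y)) (hat (z, y)) <= d1Q R (Sq n i j)) /\
  (z \in Y -> dist3 (hat (x, y)) (hat (x, z)) <= d1Q R (Sq n i j)).
Proof.
have edge k := @d1Q_edge_ge (Sq n i j) k.
have := (edge 0%N isT, edge 1%N isT, edge 2%N isT, edge 3%N isT).
rewrite /X /Y /point /= => -[[[bottom right] top] left].
have d1_ge0 := le_trans (dist3_ge0 _ _) bottom.
by rewrite !inE => /orP[]/eqP-> /orP[]/eqP->; split=> /orP[]/eqP->;
  rewrite ?dist3xx// dist3C.
Qed.

Lemma approximable_square n i j p : good_square R (Sq n i j) ->
  chull (Sq n i j) p -> approximable (Sq n i j) (hat p).
Proof.
case: p => x y [_ [x_ge [x_le [y_ge [y_le s_le]]]]] [/= x_itv y_itv].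
apply: (@thickening_small_rectangle _ _ (sq_x0 R n i) (sq_x0 R n i + side R n)
  (sq_x0 R n j) (sq_x0 R n j + side R n)) => //.
- exact: hull3_convex.
- move=> x' y'; rewrite !inE => x'E y'E; apply: hull3_mem.
  by case/orP: x'E => /eqP->; case/orP: y'E => /eqP->; rewrite !inE eqxx ?orbT.
- by split; [exact: sq_x0_side|by []..|lra].
- by split; [exact: sq_x0_side|by []..|lra].
- by move=> x' y' z xX yY zY; have [_] := d1Q_square_ge z xX yY; exact.
- by move=> x' y' z xX yY zX; have [+ _] := d1Q_square_ge z xX yY; exact.
have s2_ge0 : 0 <= side R n ^+ 2 / 2 by rewrite divr_ge0 ?sqr_ge0.
have := @diam3_hat_disk_ge _ _ _ (@DQ R (Sq n i j)) s2_ge0 (fun _ => id).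
apply: le_trans; rewrite le_eqVlt; apply/orP; left; apply/eqP.
by rewrite /corner_dot /sqr_diagonal; congr (_ / _) => /=; field.
Qed.

Lemma deltaQ_ge0 Q : 0 <= deltaQ R Q.
Proof. by case: Q => [n j|n i j|] //=; rewrite ?le_max ?chi_ge0// orbT. Qed.

Lemma dot3_hverts Q u : u \in hverts R Q -> dot3 u u = 1.
Proof.
case: Q => [n j|n i j|].
- by move=> /mapP[p _ ->]; exact: dot3_hat.
- by move=> /mapP[p _ ->]; exact: dot3_hat.
- by rewrite inE => /eqP->; exact: dot3_north.
Qed.

Definition good_cell Q := dyadic_segment Q \/ good_square R Q.

Lemma hverts_hat Q u : good_cell Q -> u \in hverts R Q ->
  exists2 p, p \in verts R Q & u = hat p.
Proof. by case: Q => [n j|n i j|] [] // _ /mapP. Qed.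

Definition placed Q v := dot3 v v = 1 /\ approximable Q v.

Lemma placed_hverts Q u : u \in hverts R Q -> placed Q u.
Proof.
move=> uQ; split; first exact: dot3_hverts uQ.
by exists u; [exact: hull3_mem|rewrite dist3xx deltaQ_ge0].
Qed.

Lemma placed_hat Q p : good_cell Q -> chull Q p -> placed Q (hat p).
Proof.
move=> Q_good Qp; split; first exact: dot3_hat.
case: Q Q_good Qp => [n j|n i j|] [] // Q_good.
  exact: approximable_segment.
exact: approximable_square.
Qed.

Lemma dot3_le_dotmax Q Q' u v : u \in hverts R Q -> placed Q' v ->
  dot3 u v <= dotmax R Q Q'.
Proof.
move=> uQ [v1 [z Q'z vz]].
have uvz : dot3 u v <= dot3 u z + deltaQ R Q'.
  rewrite -lerBlDl (dot3C u v) (dot3C u z); apply: le_trans vz.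
  by apply: dot3_sub_le_dist; rewrite (dot3_hverts uQ).
have d0 := deltaQ_ge0 Q; have dd := mulr_ge0 d0 (deltaQ_ge0 Q').
have max_le :
    dot3 u z <= maxlist [seq dot3 a b | a <- hverts R Q, b <- hverts R Q'].
  by apply: hull3_dot_le Q'z => b bQ'; apply: maxlist_ge; exact: allpairs_f.
apply: (le_trans uvz).
case: Q' Q'z dd max_le {v1 vz uvz} => [n j|n i j|] Q'z dd max_le.
- by rewrite /dotmax; lra.
- by rewrite /dotmax; lra.
rewrite /= addr0; apply: hull3_dot_le Q'z => b; rewrite inE => /eqP->.
by apply: maxlist_ge; apply/mapP; exists u.
Qed.

End Cells.

(** * Energies *)

Section Energy.
Variable R : realType.
Implicit Types (k : R) (Q : cell) (u v z : pt3 R) (w : nat -> R).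

Lemma GsC k u v : Gs k u v = Gs k v u.
Proof. by rewrite /Gs dot3C. Qed.

Lemma Gs_jensen_gap k (ps : seq (pt3 R)) w v T
    (z := \sum_(i < size ps) w i *: point ps i) :
  2 <= k -> weights (size ps) w -> {in ps, forall u, dot3 u u <= 1} ->
  dot3 v v <= 1 -> {in ps, forall u, 2 + 2 * dot3 u v <= T} ->
  \sum_(i < size ps) w i * Gs k (point ps i) v <=
  Gs k z v + 2^-1 * k * (k - 1) * powR T (k - 2) * diam3 (hull3 ps) ^+ 2.
Proof.
move=> k2 ww ps1 v1 psT; pose t i := 2 + 2 * dot3 v (point ps i).
have ps_point i : (i < size ps)%N -> point ps i \in ps.
  by move=> ?; exact: mem_nth.
have t_itv i : (i < size ps)%N -> 0 <= t i <= T.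
  move=> /ps_point p_ps; rewrite /t dot3C psT// andbT.
  by have := dot3_geN1 (ps1 _ p_ps) v1; lra.
have t_diam i j : (i < size ps)%N -> (j < size ps)%N ->
    t i - t j <= 2 * diam3 (hull3 ps).
  move=> /ps_point i_ps /ps_point j_ps.
  have hull1 : {in hull3 ps, forall x, dot3 x x <= 1}.
    by move=> x /set_mem; exact: hull3_unit_ball.
  have := dist3_le_diam3 hull1 (hull3_mem i_ps) (hull3_mem j_ps).
  have := dot3_sub_le_dist (point ps i) (point ps j) v1.
  by rewrite /t !(dot3C v); lra.
have mean_t : \sum_(i < size ps) w i * t i = 2 + 2 * dot3 z v.
  rewrite (weighted_mean_affine (fun i => dot3 v (point ps i)) _ _ ww).
  by rewrite -dot3_sumr (dot3C v).
have -> : \sum_(i < size ps) w i * Gs k (point ps i) v =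
    \sum_(i < size ps) w i * powR (t i) k.
  by apply: eq_bigr => i _; rewrite /Gs /t dot3C.
apply: (le_trans (powR_jensen_gap k2 ww t_itv t_diam)).
rewrite mean_t (mulrC 2 (diam3 _)) mulfK// lerD2l le_eqVlt.
by apply/orP; left; apply/eqP; ring.
Qed.

Lemma Gs_le_dist k u v z T d : 1 <= k -> dot3 u u <= 1 -> dot3 v v <= 1 ->
  dot3 z z <= 1 -> 2 + 2 * dot3 z v <= T -> dist3 u z <= d ->
  Gs k z v <= Gs k u v + 2 * k * powR T (k - 1) * d.
Proof.
move=> k1 u1 v1 z1 zT uz.
have uv := dot3_geN1 u1 v1; have zv := dot3_geN1 z1 v1.
have tangent : Gs k z v + k * powR (2 + 2 * dot3 z v) (k - 1) *
    (2 * (dot3 u v - dot3 z v)) <= Gs k u v.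
  have -> : 2 * (dot3 u v - dot3 z v) =
      2 + 2 * dot3 u v - (2 + 2 * dot3 z v) by ring.
  by apply: powR_tangent_le => //; lra.
have slope : powR (2 + 2 * dot3 z v) (k - 1) <= powR T (k - 1).
  by apply: ge0_ler_powR; rewrite ?nnegrE; lra.
have zu : dot3 z v - dot3 u v <= d.
  by rewrite dist3C in uz; apply: le_trans uz; exact: dot3_sub_le_dist.
have d0 : 0 <= d := le_trans (dist3_ge0 _ _) uz.
have : powR (2 + 2 * dot3 z v) (k - 1) * (dot3 z v - dot3 u v) <=
    powR T (k - 1) * d.
  by apply: le_trans (ler_wpM2l (powR_ge0 _ _) zu) _; rewrite ler_wpM2r.
move=> /(ler_wpM2l (_ : 0 <= 2 * k)); rewrite mulr_ge0//; last lra.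
by move=> /(_ isT); lra.
Qed.

Lemma weighted_Gs_le k Q Q' u v z w : 2 <= k -> weights (size (hverts R Q)) w ->
  z = \sum_(i < size (hverts R Q)) w i *: point (hverts R Q) i ->
  dot3 u u = 1 -> dist3 u z <= deltaQ R Q -> placed Q' v ->
  \sum_(i < size (hverts R Q)) w i * Gs k (point (hverts R Q) i) v <=
  Gs k u v + epsQ k Q Q'.
Proof.
move=> k2 ww zE u1 uz Q'v; have [v1 _] := Q'v.
have hullz : hull3 (hverts R Q) z by apply/hull3P; exists w.
have vert1 : {in hverts R Q, forall q, dot3 q q <= 1}.
  by move=> q /dot3_hverts->.
have vertT : {in hverts R Q, forall q, 2 + 2 * dot3 q v <= TQ R Q Q'}.
  by move=> q qQ; rewrite lerD2l ler_pM2l//; exact: dot3_le_dotmax.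
have zT : 2 + 2 * dot3 z v <= TQ R Q Q'.
  rewrite dot3C lerD2l ler_pM2l//; apply: hull3_dot_le hullz => q qQ.
  by rewrite dot3C; exact: dot3_le_dotmax.
have z1 := hull3_unit_ball vert1 hullz.
have [k1 u_le1 v_le1] : [/\ 1 <= k, dot3 u u <= 1 & dot3 v v <= 1].
  by rewrite u1 v1; split=> //; lra.
have := Gs_le_dist k1 u_le1 v_le1 z1 zT uz.
have := Gs_jensen_gap k2 ww vert1 v_le1 vertT; rewrite -zE.
case: Q ww zE uz {hullz vert1 vertT zT} => [n j|n i j|] ww zE uz.
- by rewrite /epsQ /dQ; lra.
- by rewrite /epsQ /dQ; lra.
move=> _; rewrite /epsQ /deltaQ mulr0 addr0; apply: le_trans.
move: ww => [_]; rewrite zE /= !big_ord_recl !big_ord0 !addr0 => ->.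
by rewrite mul1r scale1r.
Qed.

Definition pair_energy k n (P : 'I_n -> pt3 R) : R :=
  \sum_(i < n) \sum_(j < n | (i < j)%N) Gs k (P i) (P j).

Lemma pair_energyD1 k n (P : 'I_n -> pt3 R) i : pair_energy k P =
  \sum_(j | j != i) Gs k (P i) (P j) +
  \sum_(a | a != i) \sum_(b < n | (a < b)%N && (b != i)) Gs k (P a) (P b).
Proof.
pose G a b := Gs k (P a) (P b).
have split_at (a : 'I_n) : \sum_(b < n | (a < b)%N) G a b =
    (if (a < i)%N then G a i else 0)
    + \sum_(b < n | (a < b)%N && (b != i)) G a b.
  rewrite (bigID (pred1 i)) /=; congr (_ + _).
  by rewrite big_mkcondl big_pred1_eq.
have split_i : \sum_(j | j != i) G i j = \sum_(b < n | (i < b)%N) G i b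
    + \sum_(a | a != i) (if (a < i)%N then G a i else 0).
  rewrite (bigID (fun j : 'I_n => (i < j)%N)) /= -big_mkcondr; congr (_ + _).
    by apply: eq_bigl => j; rewrite -val_eqE /=; case: ltngtP.
  apply: eq_big => [j|j _]; last by rewrite /G GsC.
  by rewrite -val_eqE /= -leqNgt ltn_neqAle; case: eqP.
rewrite -/(G i _) split_i /pair_energy (bigD1 i)//= -addrA -big_split /=.
by congr (_ + _); apply: eq_bigr => a _; exact: split_at.
Qed.

Lemma pair_energy_dfwith k n (P : 'I_n -> pt3 R) i u :
  pair_energy k (dfwith P i u) - pair_energy k P =
  \sum_(j | j != i) (Gs k u (P j) - Gs k (P i) (P j)).
Proof.
rewrite !(pair_energyD1 k _ i) sumrB dfwithin.
have dfE j : j != i -> dfwith P i u j = P j.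
  by move=> ?; rewrite dfwithout// eq_sym.
rewrite (eq_bigr (fun j => Gs k u (P j))) => [|j /dfE->//].
rewrite [X in _ + X - _](eq_bigr (fun a : 'I_n =>
  \sum_(b < n | (a < b)%N && (b != i)) Gs k (P a) (P b))).
  by rewrite opprD addrACA subrr addr0.
move=> a /dfE ai; apply: eq_bigr => b /andP[_ /dfE bi].
by rewrite ai bi.
Qed.

Lemma vertex_replacement k n (Q : 'I_n -> cell) (P : 'I_n -> pt3 R) i :
  2 <= k -> (forall j, placed (Q j) (P j)) ->
  exists2 u, u \in hverts R (Q i) & pair_energy k (dfwith P i u) <=
    pair_energy k P + \sum_(j | j != i) epsQ k (Q i) (Q j).
Proof.
move=> k2 QP; have [Pi1 [z /hull3P[w ww zE] Piz]] := QP i.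
pose h := hverts R (Q i).
pose f m := \sum_(j | j != i) Gs k (point h m) (P j).
have : \sum_(m < size h) w m * f m <=
    \sum_(j | j != i) (Gs k (P i) (P j) + epsQ k (Q i) (Q j)).
  under eq_bigr do rewrite mulr_sumr.
  rewrite exchange_big; apply: ler_sum => j _ /=.
  exact: weighted_Gs_le zE _ _ _.
move=> /(weighted_mean_ex_le ww)[m m_lt fm].
exists (point h m); first exact: mem_nth.
by rewrite -lerBlDl pair_energy_dfwith sumrB lerBlDl -big_split.
Qed.

Lemma exists_vertex_configuration k n (Q : 'I_n -> cell) (P : 'I_n -> pt3 R) :
  2 <= k -> (forall i, placed (Q i) (P i)) ->
  exists2 V, (forall i, V i \in hverts R (Q i)) & pair_energy k V <=
    pair_energy k P + \sum_i \sum_(j | j != i) epsQ k (Q i) (Q j).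
Proof.
move=> k2 QP.
suff [V [_ inV V_le]] : exists V, [/\ forall i, placed (Q i) (V i),
    {in enum 'I_n, forall i, V i \in hverts R (Q i)} &
    pair_energy k V <= pair_energy k P +
      \sum_(i <- enum 'I_n) \sum_(j | j != i) epsQ k (Q i) (Q j)].
  exists V => [i|]; last by rewrite big_enum in V_le.
  by apply: inV; rewrite mem_enum.
elim: (enum 'I_n) => [|i s [V [QV inV V_le]]].
  by exists P; split=> //; rewrite big_nil addr0.
have [u uQ u_le] := vertex_replacement i k2 QV.
exists (dfwith V i u); split=> [j|j|].
- by case: dfwithP => [|j' _] //; exact: placed_hverts.
- by case: dfwithP => // j' ij'; rewrite inE eq_sym (negPf ij') => /inV.
- by rewrite big_cons; apply: (le_trans u_le); lra.
Qed.

Definition block Q0 Q1 Q2 Q3 (i : 'I_5) : cell :=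
  nth Inf [:: Q0; Q1; Q2; Q3; Inf] i.

Lemma ERR_block k Q0 Q1 Q2 Q3 (Q := block Q0 Q1 Q2 Q3) :
  ERR k Q0 Q1 Q2 Q3 = \sum_i \sum_(j | j != i) epsQ k (Q i) (Q j).
Proof.
by rewrite big_ord_recr /= [X in _ + X]big1 ?addr0// => j _; case: (Q j).
Qed.

Lemma min_vertex_energy_le k Q0 Q1 Q2 Q3 (V : 'I_5 -> pt3 R) :
  good_cell R Q0 -> good_cell R Q1 -> good_cell R Q2 -> good_cell R Q3 ->
  (forall i, V i \in hverts R (block Q0 Q1 Q2 Q3 i)) ->
  min_vertex_energy k Q0 Q1 Q2 Q3 <= pair_energy k V.
Proof.
move=> g0 g1 g2 g3 inV.
have [q0 q0Q V0] := hverts_hat g0 (inV (@Ordinal 5 0 isT)).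
have [q1 q1Q V1] := hverts_hat g1 (inV (@Ordinal 5 1 isT)).
have [q2 q2Q V2] := hverts_hat g2 (inV (@Ordinal 5 2 isT)).
have [q3 q3Q V3] := hverts_hat g3 (inV (@Ordinal 5 3 isT)).
have := inV (@Ordinal 5 4 isT); rewrite inE => /eqP V4.
have VE i : V i = nth (north R) [:: hat q0; hat q1; hat q2; hat q3; north R] i.
  by case: i => [[|[|[|[|[|//]]]]] lt_i] /=; rewrite -?V0 -?V1 -?V2 -?V3 -?V4;
    congr V; exact: val_inj.
have -> : pair_energy k V = energy k q0 q1 q2 q3.
  by apply: eq_bigr => i _; apply: eq_bigr => j _; rewrite !VE.
apply: minlist_le; apply/mapP; exists ((q0, q1), (q2, q3)) => //.
by apply: allpairs_f; apply: allpairs_f.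
Qed.

End Energy.

Theorem theorem4p1 (R : realType) (k : R) (hk : 2 <= k)
  (Q0 Q1 Q2 Q3 : cell)
  (h0 : dyadic_segment Q0) (h1 : good_square R Q1) (h2 : good_square R Q2)
  (h3 : good_square R Q3) :
  forall p0 p1 p2 p3 : pt2 R,
    chull Q0 p0 -> chull Q1 p1 -> chull Q2 p2 -> chull Q3 p3 ->
    min_vertex_energy k Q0 Q1 Q2 Q3 - ERR k Q0 Q1 Q2 Q3 <= energy k p0 p1 p2 p3.
Proof.
move=> p0 p1 p2 p3 c0 c1 c2 c3.
have g0 : good_cell R Q0 by left.
have [g1 g2 g3] : [/\ good_cell R Q1, good_cell R Q2 & good_cell R Q3].
  by split; right.
pose P (i : 'I_5) :=
  nth (north R) [:: hat p0; hat p1; hat p2; hat p3; north R] i.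
have P_placed i : placed (block Q0 Q1 Q2 Q3 i) (P i).
  case: i => [[|[|[|[|[|//]]]]] lt_i].
  1-4: exact: placed_hat.
  by apply: placed_hverts; rewrite mem_head.
have [V V_vertices V_le] := exists_vertex_configuration hk P_placed.
rewrite lerBlDr ERR_block; apply: le_trans V_le.
exact: min_vertex_energy_le.
Qed.
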